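(* Suppose $X$ is similar to the Hawaiian earring, suppose $Y$ is metrizable, and suppose the topological fundamental group $\pi_1(Y,p)$ is completely metrizable. Then $X$ cannot be embedded as a retract of $Y$.
   Context: Similar to the Hawaiian earring: a metric space $(X,d)$ is similar to the Hawaiian earring provided all of the following hold: $p\in X$ and $X=\bigcup_{n=1}^{\infty}Y_n$ with $Y_n\cap Y_m=\{p\}$ whenever $n\neq m$; each space $Y_n$ is path connected, locally simply connected at $p$, and not simply connected; and $\lim_{n\to\infty}\operatorname{diam}(Y_n)=0$. For example, if each $Y_n$ is a simple closed curve then $X$ is the familiar Hawaiian earring. Topological fundamental group: for a metrizable space $W$ and a base point $p\in W$, let $C_p(W)=\{f:[0,1]\to W : f \text{ continuous}, f(0)=f(1)=p\}$ with the topology of uniform convergence. The topological fundamental group $\pi_1(W,p)$ is the set of path components of $C_p(W)$, endowed with the quotient topology under the canonical surjection $q:C_p(W)\to\pi_1(W,p)$, where $q(f)=q(g)$ if and only if $f$ and $g$ belong to the same path component of $C_p(W)$. Thus $U\subset \pi_1(W,p)$ is open if and only if $q^{-1}(U)$ is open in $C_p(W)$. The same letter $p$ is used for the base point of each space. If $A\subset Y$, then $A$ is a retract of $Y$ if there is a continuous map $f:Y\to A$ with $f|_A=\mathrm{id}_A$. ''$X$ can be embedded as a retract of $Y$'' means that some retract of $Y$ is homeomorphic to $X$. A topological space is completely metrizable if it admits a complete metric compatible with its topology.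
   Formalization: The pieces Y_n are additionally assumed closed in X (without this the claim fails, e.g. for a suitable decomposition of the closed unit ball of R^3), and the retract homeomorphic to X is required to meet the path component of the base point p of Y. *)

(* Defs.v *)
From HB Require Import structures.
From mathcomp Require Import all_boot all_order all_algebra generic_quotient.
From mathcomp Require Import all_classical all_reals all_analysis homotopy.
Set Implicit Arguments.
Unset Strict Implicit.
Unset Printing Implicit Defensive.
Import Order.TTheory GRing.Theory Num.Theory.
Import numFieldNormedType.Exports.
Local Open Scope classical_set_scope.
Local Open Scope quotient_scope.
Local Open Scope ring_scope.

Definition unit_itv (R : realType) : Type := set_type (`[0, 1]%classic : set R).

Section unit_interval.
Context {R : realType}.

HB.instance Definition _ :=
  Uniform.copy (unit_itv R) (set_type (`[0, 1]%classic : set R)).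

Let clamp_fun (r : R) : R := Num.max 0 (Num.min r 1).

Lemma clamp_subproof (r : R) : clamp_fun r \in (`[0, 1]%classic : set R).
Proof.
by rewrite /clamp_fun inE/= in_itv/= le_max lexx/= ge_max ler01 ge_min lexx orbT.
Qed.

Definition clamp (r : R) : unit_itv R := exist _ (clamp_fun r) (clamp_subproof r).

Lemma unit_itvP (t : unit_itv R) : 0 <= val t <= 1.
Proof. by case: t => r /= /set_mem; rewrite /= in_itv. Qed.

Lemma clamp_val (r : R) : 0 <= r <= 1 -> val (clamp r) = r.
Proof. by case/andP => r0 r1 /=; rewrite /clamp_fun min_l// max_r. Qed.

Lemma clampK (t : unit_itv R) : clamp (val t) = t.
Proof. by apply: val_inj; rewrite clamp_val// unit_itvP. Qed.

Lemma continuous_unit_itv_val : continuous (val : unit_itv R -> R).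
Proof. exact: initial_continuous. Qed.

Lemma continuous_clamp : continuous clamp.
Proof.
apply/continuous_comp_initial => x.
apply: (@continuous_max R R (cst 0) (fun r => Num.min r 1)).
  exact: cvg_cst.
by apply: (@continuous_min R R id (cst 1)); [exact: cvg_id|exact: cvg_cst].
Qed.

Lemma clamp01 : clamp 0 != clamp 1.
Proof.
by apply/eqP => /(congr1 val); rewrite !clamp_val ?lexx ?ler01//= => /esym/eqP;
  rewrite oner_eq0.
Qed.

HB.instance Definition _ := isBiPointed.Build (unit_itv R) clamp01.

Lemma unit_itv0 : (zero : unit_itv R) = clamp 0. Proof. by []. Qed.
Lemma unit_itv1 : (one : unit_itv R) = clamp 1. Proof. by []. Qed.

End unit_interval.

Definition path_joined (R : realType) (T : topologicalType) (x y : T) : Prop :=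
  $| {path unit_itv R from x to y in T} |.

Section path_joined_equivalence.
Context {R : realType} {T : topologicalType}.
Local Notation I := (unit_itv R).
Implicit Types x y z : T.

Lemma path_joined_of x y (f : I -> T) :
  continuous f -> f zero = x -> f one = y -> path_joined R x y.
Proof. by move=> cf f0 f1; exists; exact: (mk_path cf f0 f1). Qed.

Lemma path_joined_refl x : path_joined R x x.
Proof. by apply: (@path_joined_of _ _ (cst x)) => //; exact: cst_continuous. Qed.

Lemma path_joined_sym x y : path_joined R x y -> path_joined R y x.
Proof.
case=> f; apply: (@path_joined_of _ _ (fun t => f (clamp (1 - val t)))).
- move=> t; apply: (@continuous_comp _ _ _ (fun t : I => clamp (1 - val t)) f);
    last exact: cts_fun.
  apply: (@continuous_comp _ _ _ (fun t : I => 1 - val t) clamp);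
    last exact: continuous_clamp.
  apply: continuousB; [exact: cst_continuous|exact: continuous_unit_itv_val].
- by rewrite unit_itv0 clamp_val ?lexx ?ler01// subr0 -unit_itv1 path_one.
- by rewrite unit_itv1 clamp_val ?lexx ?ler01// subrr -unit_itv0 path_zero.
Qed.

Lemma path_joined_trans x y z :
  path_joined R x y -> path_joined R y z -> path_joined R x z.
Proof.
case=> f [g].
pose c1 (t : I) := clamp (2 * val t); pose c2 (t : I) := clamp (2 * val t - 1).
have c2v : continuous (fun t : I => 2 * val t : R).
  move=> t; apply: (continuousM (s := cst 2 : I -> R) (t := val : I -> R)).
    exact: cst_continuous.
  exact: continuous_unit_itv_val.
have cc1 : continuous (f \o c1).
  move=> t; apply: continuous_comp; last exact: cts_fun.
  by apply: continuous_comp; [exact: c2v|exact: continuous_clamp].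
have cc2 : continuous (g \o c2).
  move=> t; apply: continuous_comp; last exact: cts_fun.
  apply: (@continuous_comp _ _ _ (fun t : I => 2 * val t - 1) clamp);
    last exact: continuous_clamp.
  apply: continuousB; [exact: c2v|exact: cst_continuous].
pose h t := if 2 * val t <= 1 then f (c1 t) else g (c2 t).
pose A := [set t : I | 2 * val t <= 1]; pose B := [set t : I | 1 <= 2 * val t].
have cA : closed A.
  by apply: (@preimage_closed _ _ (fun t : I => 2 * val t) [set r | r <= 1]);
    [move=> t _; exact: c2v|exact: closed_le].
have cB : closed B.
  by apply: (@preimage_closed _ _ (fun t : I => 2 * val t) [set r | 1 <= r]);
    [move=> t _; exact: c2v|exact: closed_ge].
have AB : A `|` B = setT.
  by apply/seteqP; split=> // t _; rewrite /A /B/=; case: (leP (2 * val t) 1);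
    [left|move/ltW; right].
have hA t : A t -> h t = f (c1 t) by move=> At; rewrite /h ifT.
have hB t : B t -> h t = g (c2 t).
  move=> Bt; rewrite /h; case: ifPn => // At.
  have t12 : 2 * val t = 1 by apply/eqP; rewrite eq_le At; exact: Bt.
  by rewrite /c1 /c2 t12 subrr -unit_itv0 -unit_itv1 path_zero path_one.
apply: (@path_joined_of _ _ h).
- apply/continuous_subspace_setT; rewrite -AB; apply: withinU_continuous => //.
  + apply: (@subspace_eq_continuous _ _ _ (f \o c1)).
      by move=> t /set_mem At; exact/esym/hA.
    exact: continuous_subspaceT.
  + apply: (@subspace_eq_continuous _ _ _ (g \o c2)).
      by move=> t /set_mem Bt; exact/esym/hB.
    exact: continuous_subspaceT.
- rewrite /h /c1 unit_itv0 clamp_val ?lexx ?ler01// mulr0 ler01.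
  by rewrite -unit_itv0 path_zero.
- rewrite /h /c2 unit_itv1 clamp_val ?lexx ?ler01// mulr1.
  rewrite ifF; last by apply/negbTE; rewrite -ltNge ltr1n.
  by rewrite -[X in 2 - X]/(1%:R) -natrB// -unit_itv1 path_one.
Qed.

End path_joined_equivalence.

(* The library topologizes path types with the compact-open topology; this
   alias carries the uniformity of uniform convergence on [0, 1] instead. *)
Definition loop_space (R : realType) (T : uniformType) (p : T) : Type :=
  {path unit_itv R from p to p in T}.

HB.instance Definition _ (R : realType) (T : uniformType) (p : T) :=
  Choice.on (loop_space R p).
HB.instance Definition _ (R : realType) (T : uniformType) (p : T) :=
  Uniform.copy (loop_space R p)
    (initial_topology ((fun f => f : unit_itv R -> T) :
      loop_space R p -> {uniform unit_itv R -> T})).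

Section fundamental_group.
Context (R : realType) (T : uniformType) (p : T).

Definition loop_rel : rel (loop_space R p) := fun f g => `[< path_joined R f g >].

Lemma loop_rel_refl : reflexive loop_rel.
Proof. by move=> f; apply/asboolP; exact: path_joined_refl. Qed.

Lemma loop_rel_sym : symmetric loop_rel.
Proof. by move=> f g; apply/asboolP/asboolP => /path_joined_sym. Qed.

Lemma loop_rel_trans : transitive loop_rel.
Proof.
by move=> g f h /asboolP fg /asboolP gh; apply/asboolP; exact: path_joined_trans gh.
Qed.

Canonical loop_equiv := EquivRel loop_rel loop_rel_refl loop_rel_sym loop_rel_trans.

Definition pi1 : Type := {eq_quot loop_equiv}.

HB.instance Definition _ := Quotient.on pi1.
HB.instance Definition _ := Topological.copy pi1 (quotient_topology pi1).

End fundamental_group.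

Definition path_connected_space (R : realType) (T : topologicalType) : Prop :=
  forall x y : T, path_joined R x y.

Definition simply_connected (R : realType) (T : uniformType) : Prop :=
  path_connected_space R T /\ forall (x : T) (a b : pi1 R x), a = b.

Definition locally_simply_connected_at (R : realType) (T : uniformType) (x : T) :
    Prop :=
  forall U : set T, nbhs x U ->
    exists V : set T, [/\ nbhs x V, V `<=` U & simply_connected R (set_type V)].

Definition diam (R : realType) (X : metricType R) (A : set X) : \bar R :=
  ereal_sup [set (mdist xy.1 xy.2)%:E | xy in A `*` A].

(* Closedness of the pieces is essential: it makes X a wedge, i.e. it makes
   collapsing all pieces but one to p continuous. Without it the contractible
   unit ball of R^3 would qualify: with L_n pairwise distinct lines through
   p = 0, let Y_n be {x | 2^-n <= |x| < 2^-(n-1)} (<= 1 when n = 1) minus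
   L_1, ..., L_(n-1), together with {x in L_n | |x| <= 2^-n}. *)
Definition similar_to_hawaiian_earring (R : realType) (X : metricType R) (p : X) :
    Prop :=
  exists Y : nat -> set X,
    [/\ \bigcup_n Y n = [set: X],
        forall n m, n != m -> Y n `&` Y m = [set p],
        forall n, closed (Y n),
        forall n, [/\ path_connected_space R (set_type (Y n)),
          (forall q : set_type (Y n), val q = p -> locally_simply_connected_at R q)
          & ~ simply_connected R (set_type (Y n))]
      & diam (Y n) @[n --> \oo] --> 0%E].

Definition is_metric (R : realType) (T : Type) (d : T -> T -> R) : Prop :=
  [/\ forall x y, 0 <= d x y, forall x y, d x y = 0 <-> x = y,
      forall x y, d x y = d y x & forall x y z, d x z <= d x y + d y z].

Definition completely_metrizable (R : realType) (T : topologicalType) : Prop :=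
  exists d : T -> T -> R,
    [/\ is_metric d,
        (forall (x : T) (U : set T),
          nbhs x U <-> exists2 e : R, 0 < e & [set y | d x y < e] `<=` U)
      & forall u : nat -> T,
          (forall e : R, 0 < e -> exists N : nat,
            forall m n, (N <= m)%N -> (N <= n)%N -> d (u m) (u n) < e) ->
          exists l : T, u @ \oo --> l].

Definition homeomorphism (S T : topologicalType) (h : S -> T) : Prop :=
  continuous h /\
  exists g : T -> S, [/\ continuous g, cancel h g & cancel g h].

Definition homeomorphic (S T : topologicalType) : Prop :=
  exists h : S -> T, homeomorphism h.

Definition retract (T : topologicalType) (A : set T) : Prop :=
  exists f : T -> set_type A, continuous f /\ forall a : set_type A, f (val a) = a.

(* The fundamental group at p only sees the path component of p, so base points
   are tied together by asking that the retract meet that component. This covers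
   the case of a base point preserving embedding as well as that of an arbitrary
   embedding into a path connected space. Without any such condition X would
   embed as a retract of its disjoint union with an isolated base point. *)
Definition embeds_as_based_retract (R : realType) (X Y : topologicalType) (p : Y) :
    Prop :=
  exists A : set Y,
    [/\ retract A, homeomorphic X (set_type A)
      & exists2 a : Y, A a & path_joined R p a].
Arguments embeds_as_based_retract : clear implicits.
Arguments embeds_as_based_retract R X {Y} p.

(* Main.v *)
(** Write [w_n(a, b)] for the n-th power of the commutator of [a] and [b]. Choose
    essential loops [b_n] in [Y_n]. As [k] grows, [b_k] shrinks to the constant
    loop, so [g * w_n(b_0, b_k)] converges to [g * w_n(b_0, 1) = g]. Completeness of
    [pi_1(Y, p)], of which [pi_1(X, p)] is a retract, hence yields a loop [f] in
    [X] whose projection to [Y_0] and [Y_(k_j)] is homotopic to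
    [w_j(b_0, b_(k_j))] for every [j]. This is absurd: by uniform continuity [f]
    makes only [M] excursions in [Y_0] leaving a given simply connected
    neighbourhood of [p], so all of these projections are products of boundedly
    many syllables in the free product, while [w_j] has syllable length [4 j].

    The syllable length is homotopy invariant by a van Kampen argument: a loop in
    the union of two pieces acts on normal forms of the free product through fine
    dyadic subdivisions, and small squares of a homotopy act consistently because
    each of them stays in a simply connected neighbourhood of [p] in one of the
    two pieces. *)
Require Import Defs.
From HB Require Import structures.
From mathcomp Require Import all_boot all_order all_algebra generic_quotient.
From mathcomp Require Import all_classical all_reals all_analysis homotopy.
From mathcomp Require Import ring lra.
Set Implicit Arguments.
Unset Strict Implicit.
Unset Printing Implicit Defensive.
Import Order.TTheory GRing.Theory Num.Theory.
Import numFieldNormedType.Exports.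
Local Open Scope classical_set_scope.
Local Open Scope quotient_scope.
Local Open Scope ring_scope.

(** Multiplication in [pi1] with the quotient topology need not be jointly continuous, so [pi1] is
    never treated as a topological group: a word is appended to one fixed loop at a time, and its
    index is chosen only after that loop is known. Limits are compared in the fundamental group of
    the ambient space, where a metric separates points; the collapses of the wedge are carried over
    to it through the embedding and the retraction.

    Commutators serve two purposes: they become trivial as soon as one entry does, and their powers
    keep full syllable length even when the entries have finite order. Keeping b_0 in all words ties
    every count to one piece: squares are measured by the projection to that piece alone, so one
    mesh serves all indices k at once.

    The free product is present only through its operation on reduced words. The outcome for a loop
    depends on the depth of subdivision; homotopic loops give the same outcome from some depth
    on. *)

(** * Continuity of composite and glued functions *)

Lemma continuous_if_le (R : realType) (Z T : topologicalType) (u : Z -> R)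
    (c : R) (f g : Z -> T) :
  continuous u -> continuous f -> continuous g ->
  (forall z, u z = c -> f z = g z) ->
  continuous (fun z => if u z <= c then f z else g z).
Proof.
move=> cu cf cg fg.
pose A := [set z | u z <= c]; pose B := [set z | c <= u z].
have cA : closed A.
  by apply: (@preimage_closed _ _ u [set r | r <= c]);
    [move=> z _; exact: cu|exact: closed_le].
have cB : closed B.
  by apply: (@preimage_closed _ _ u [set r | c <= r]);
    [move=> z _; exact: cu|exact: closed_ge].
have AB : A `|` B = setT.
  by apply/seteqP; split=> // z _; rewrite /A /B/=; case: (leP (u z) c);
    [left|move/ltW; right].
apply/continuous_subspace_setT; rewrite -AB; apply: withinU_continuous => //.
- apply: (@subspace_eq_continuous _ _ _ f).
    by move=> z /set_mem Az; rewrite /from_subspace ifT.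
  exact: continuous_subspaceT.
- apply: (@subspace_eq_continuous _ _ _ g).
    move=> z /set_mem Bz; rewrite /from_subspace; case: ifPn => // uz; apply/esym/fg.
    by apply/eqP; rewrite eq_le uz.
  exact: continuous_subspaceT.
Qed.

Lemma continuous_comp_fun (A B C : topologicalType) (f : A -> B) (g : B -> C) :
  continuous f -> continuous g -> continuous (fun a => g (f a)).
Proof. by move=> cf cg a; apply: continuous_comp; [exact: cf|exact: cg]. Qed.

Lemma continuous_pair_fun (A B C : topologicalType) (f : A -> B) (g : A -> C) :
  continuous f -> continuous g -> continuous (fun a => (f a, g a)).
Proof. by move=> cf cg a; apply: cvg_pair; [exact: cf|exact: cg]. Qed.

Lemma continuous_pairl (A B : topologicalType) (a : A) :
  continuous (pair a : B -> A * B).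
Proof. by move=> b; apply: cvg_pair; [exact: cvg_cst|exact: cvg_id]. Qed.

Lemma continuous_fst_fun (A B C : topologicalType) (f : A -> B * C) :
  continuous f -> continuous (fun a => (f a).1).
Proof. by move=> cf a; apply: cvg_comp; [exact: cf|exact: cvg_fst]. Qed.

Lemma continuous_snd_fun (A B C : topologicalType) (f : A -> B * C) :
  continuous f -> continuous (fun a => (f a).2).
Proof. by move=> cf a; apply: cvg_comp; [exact: cf|exact: cvg_snd]. Qed.

Section real_valued.
Context {R : realType} {Z : topologicalType}.
Implicit Types f g : Z -> R.

Lemma continuousD_fun f g :
  continuous f -> continuous g -> continuous (fun z => f z + g z).
Proof. by move=> cf cg z; apply: continuousD; [exact: cf|exact: cg]. Qed.

Lemma continuousN_fun f : continuous f -> continuous (fun z => - f z).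
Proof. by move=> cf z; apply: continuousN; exact: cf. Qed.

Lemma continuousM_fun f g :
  continuous f -> continuous g -> continuous (fun z => f z * g z).
Proof. by move=> cf cg z; apply: (continuousM (cf z) (cg z)). Qed.

Lemma continuous_min_fun f g :
  continuous f -> continuous g -> continuous (fun z => Num.min (f z) (g z)).
Proof. by move=> cf cg z; apply: continuous_min; [exact: cf|exact: cg]. Qed.

Lemma continuous_max_fun f g :
  continuous f -> continuous g -> continuous (fun z => Num.max (f z) (g z)).
Proof. by move=> cf cg z; apply: continuous_max; [exact: cf|exact: cg]. Qed.

End real_valued.

Lemma continuous_opp_real (R : realType) : continuous (-%R : R -> R).
Proof. by move=> x; apply: continuousN; exact: cvg_id. Qed.

Lemma continuous_addl_real (R : realType) (c : R) : continuous (+%R c : R -> R).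
Proof. by move=> x; apply: continuousD; [exact: cvg_cst|exact: cvg_id]. Qed.

Lemma continuous_mull_real (R : realType) (c : R) : continuous ( *%R c : R -> R).
Proof. by move=> x; apply: continuousM; [exact: cvg_cst|exact: cvg_id]. Qed.

(** Homotopies are continuous on the whole plane but have prescribed values only along the unit
    square. Precomposing with [clampr] makes two of them agree along an entire gluing line. *)
Definition clampr {R : realType} (t : R) : R := val (clamp t).

Lemma clampr_id (R : realType) (t : R) : 0 <= t <= 1 -> clampr t = t.
Proof. exact: clamp_val. Qed.

Lemma clampr01 (R : realType) (t : R) : 0 <= clampr t <= 1.
Proof. exact: unit_itvP. Qed.

Lemma continuous_clampr (R : realType) : continuous (@clampr R).
Proof.
exact: continuous_comp_fun continuous_clamp continuous_unit_itv_val.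
Qed.

Ltac cts_step :=
  lazymatch goal with
  | |- continuous (fun _ => ?c) => exact: cst_continuous
  | |- continuous (fun x => x) => by move=> ?; exact: cvg_id
  | |- continuous (fun x => (_ + _)%R) => apply: continuousD_fun
  | |- continuous (fun x => (- _)%R) => apply: continuousN_fun
  | |- continuous (fun x => (_ * _)%R) => apply: continuousM_fun
  | |- continuous (fun x => Num.min _ _) => apply: continuous_min_fun
  | |- continuous (fun x => Num.max _ _) => apply: continuous_max_fun
  | |- continuous (fun x => (_, _)) => apply: continuous_pair_fun
  | |- continuous (fun x => _.1) => apply: continuous_fst_fun
  | |- continuous (fun x => _.2) => apply: continuous_snd_fun
  | |- continuous (fun x => clampr _) =>
      apply: (continuous_comp_fun _ (@continuous_clampr _))
  | |- continuous (@GRing.opp _) => exact: continuous_opp_real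
  | |- continuous (@GRing.add _ _) => exact: continuous_addl_real
  | |- continuous (@GRing.mul _ _) => exact: continuous_mull_real
  | |- continuous id => by move=> ?; exact: cvg_id
  | |- continuous (pair _) => exact: continuous_pairl
  | |- continuous fst => by move=> ?; exact: cvg_fst
  | |- continuous snd => by move=> ?; exact: cvg_snd
  | H : continuous ?f |- continuous ?f => exact: H
  | H : continuous ?f |- continuous (fun x => ?f _) =>
      apply: (continuous_comp_fun _ H)
  end.
Ltac cts := repeat cts_step.


Ltac split_cases := repeat
  match goal with
  | |- context [Num.min ?a ?b] => case: (leP a b) => ?
  | |- context [Num.max ?a ?b] => case: (leP a b) => ?
  | |- context [?a <= ?b] => case: (leP a b) => ? //=
  end.
(* [lra] aborts on equalities outside of [R], even among the hypotheses, when the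
   goal does not determine [R]. *)
Ltac piecewise R := split_cases;
  solve [done | congr (_ _); lra
        | exfalso; have: (1 < 0 :> R); [lra|by rewrite ltr10]].

(** * Paths up to homotopy *)

Section path_homotopy.
Context {R : realType} {T : topologicalType}.
Implicit Types (f g h k : R -> T) (x y z : T).

(* Paths are functions on the whole line of which only the restriction to
   [0, 1] matters. *)
Definition is_path x y f := [/\ continuous f, f 0 = x & f 1 = y].

(** The first coordinate is the homotopy parameter, the second runs along the paths. *)
Definition path_homotopic f g := exists H : R * R -> T,
  [/\ continuous H,
      forall t, 0 <= t <= 1 -> H (0, t) = f t /\ H (1, t) = g t &
      forall s, 0 <= s <= 1 -> H (s, 0) = f 0 /\ H (s, 1) = f 1].

Definition pcat f g (t : R) : T := if t <= 2^-1 then f (2 * t) else g (2 * t - 1).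

Definition revp f (t : R) : T := f (1 - t).

Lemma path_homotopic_ends f g : path_homotopic f g -> f 0 = g 0 /\ f 1 = g 1.
Proof.
case=> H [_ Hfg Hs].
have [_ <-] := Hfg 0 ltac:(lra); have [_ <-] := Hfg 1 ltac:(lra).
by have [-> ->] := Hs 1 ltac:(lra).
Qed.

Lemma path_homotopic_eq f g :
  continuous f -> (forall t, 0 <= t <= 1 -> f t = g t) -> path_homotopic f g.
Proof.
move=> cf fg; exists (fun z : R * R => f z.2); split=> //=; first by cts.
by move=> t t01; split=> //; exact: fg.
Qed.

Lemma path_homotopic_refl f : continuous f -> path_homotopic f f.
Proof. by move=> cf; exact: path_homotopic_eq. Qed.

Lemma path_homotopic_sym f g : path_homotopic f g -> path_homotopic g f.
Proof.
move=> fg; have [f0 f1] := path_homotopic_ends fg.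
case: fg => H [cH Hfg Hs]; exists (fun z : R * R => H (1 - z.1, z.2)); split=> /=.
- by cts.
- by move=> t t01; rewrite subr0 subrr; have [] := Hfg t t01.
- by move=> s s01; rewrite -f0 -f1; apply: Hs; lra.
Qed.

Lemma path_homotopic_trans g f h :
  path_homotopic f g -> path_homotopic g h -> path_homotopic f h.
Proof.
move=> fg; have [f0 f1] := path_homotopic_ends fg.
case: fg => H [cH Hfg Hs] [K [cK Kgh Ks]].
exists (fun z : R * R => if z.1 <= 2^-1 then H (2 * z.1, clampr z.2)
                 else K (2 * z.1 - 1, clampr z.2)); split=> /=.
- apply: (continuous_if_le (u := fst)); [by cts|by cts| by cts|].
  move=> [s t] /= ->; rewrite mulfV// subrr.
  by have [_ ->] := Hfg _ (clampr01 t); have [->] := Kgh _ (clampr01 t).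
- move=> t t01; rewrite clampr_id// mulr0 mulr1 ifT; last by lra.
  rewrite ifF; last by lra.
  have -> : 2 - 1 = 1 :> R by lra.
  by have [-> _] := Hfg _ t01; have [_ ->] := Kgh _ t01.
- move=> s s01; rewrite !clampr_id; [|lra|lra].
  by case: ifPn => s2; [apply: Hs|rewrite f0 f1; apply: Ks]; lra.
Qed.

Lemma continuous_pcat f g :
  continuous f -> continuous g -> f 1 = g 0 -> continuous (pcat f g).
Proof.
move=> cf cg fg; apply: (continuous_if_le (u := id)); [by cts|by cts|by cts|].
by move=> t ->; rewrite mulfV// subrr.
Qed.

Lemma continuous_revp f : continuous f -> continuous (revp f).
Proof. by move=> cf; rewrite /revp; cts. Qed.

Lemma is_path_cst x : is_path x x (cst x).
Proof. by split=> //; exact: cst_continuous. Qed.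

Lemma pcat0 f g : pcat f g 0 = f 0.
Proof. by rewrite /pcat mulr0 ifT//; lra. Qed.

Lemma pcat1 f g : pcat f g 1 = g 1.
Proof. by rewrite /pcat ifF; [congr (g _)|]; lra. Qed.

Lemma is_path_pcat y x z f g :
  is_path x y f -> is_path y z g -> is_path x z (pcat f g).
Proof.
move=> [cf f0 f1] [cg g0 g1]; split; rewrite ?pcat0 ?pcat1//.
by apply: continuous_pcat => //; rewrite f1.
Qed.

Lemma is_path_revp x y f : is_path x y f -> is_path y x (revp f).
Proof.
move=> [cf f0 f1]; split; first exact: continuous_revp.
- by rewrite /revp subr0.
- by rewrite /revp subrr.
Qed.

Lemma path_homotopic_pcat f f' g g' : f 1 = g 0 ->
  path_homotopic f f' -> path_homotopic g g' ->
  path_homotopic (pcat f g) (pcat f' g').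
Proof.
move=> fg [H [cH Hf Hs]] [K [cK Kg Ks]].
exists (fun z : R * R => if z.2 <= 2^-1 then H (clampr z.1, 2 * z.2)
                 else K (clampr z.1, 2 * z.2 - 1)); split=> /=.
- apply: (continuous_if_le (u := snd)); [by cts|by cts|by cts|].
  move=> [s t] /= ->; rewrite mulfV// subrr.
  by have [_ ->] := Hs _ (clampr01 s); have [->] := Ks _ (clampr01 s).
- move=> t t01; rewrite /pcat !clampr_id; [|lra|lra].
  by case: ifPn => t2; [apply: Hf|apply: Kg]; lra.
- move=> s s01; rewrite pcat0 pcat1 clampr_id// mulr0 ifT; last by lra.
  rewrite ifF; last by lra.
  have -> : 2 * 1 - 1 = 1 :> R by lra.
  by have [-> _] := Hs _ s01; have [_ ->] := Ks _ s01.
Qed.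

Lemma path_homotopic_revp f g :
  path_homotopic f g -> path_homotopic (revp f) (revp g).
Proof.
move=> [H [cH Hfg Hs]]; exists (fun z : R * R => H (z.1, 1 - z.2)); split=> /=.
- by cts.
- by move=> t t01; apply: Hfg; lra.
- by move=> s /Hs[? ?]; rewrite /revp subr0 subrr.
Qed.

(** Two plane curves with common ends are joined by segments, and [F] pushes this homotopy forward.
    The case of one variable is reparametrization; the case of two variables moves a path across a
    square. *)
Lemma path_homotopic_straight (F : R * R -> T) (a b a' b' : R -> R) :
  continuous F -> continuous a -> continuous b -> continuous a' -> continuous b' ->
  a 0 = a' 0 -> b 0 = b' 0 -> a 1 = a' 1 -> b 1 = b' 1 ->
  path_homotopic (fun t => F (a t, b t)) (fun t => F (a' t, b' t)).
Proof.
move=> cF ca cb ca' cb' a0 b0 a1 b1.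
exists (fun z : R * R =>
  F (a z.2 + z.1 * (a' z.2 - a z.2), b z.2 + z.1 * (b' z.2 - b z.2))).
split=> /=; first by cts.
- by move=> t t01; split; congr (F (_, _)); ring.
- by move=> s s01; split; congr (F (_, _)); rewrite ?a0 ?b0 ?a1 ?b1; ring.
Qed.

Lemma path_homotopic_reparam f (a a' : R -> R) :
  continuous f -> continuous a -> continuous a' -> a 0 = a' 0 -> a 1 = a' 1 ->
  path_homotopic (fun t => f (a t)) (fun t => f (a' t)).
Proof.
move=> cf ca ca' a0 a1.
by apply: (path_homotopic_straight (F := fun z : R * R => f z.1)) => //; cts.
Qed.

(** Both bracketings reparametrize a single path [F] that runs through [f], [g], [h] on the unit
    intervals of [0, 3]; the minimum and the maximum below are the two piecewise linear
    reparametrizations. *)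
Lemma pcatA f g h : continuous f -> continuous g -> continuous h ->
  f 1 = g 0 -> g 1 = h 0 ->
  path_homotopic (pcat (pcat f g) h) (pcat f (pcat g h)).
Proof.
move=> cf cg ch fg gh.
pose F t := if t <= 1 then f t else if t <= 2 then g (t - 1) else h (t - 2).
have cF : continuous F.
  apply: (continuous_if_le (u := id)) => //; first by cts.
    apply: (continuous_if_le (u := id)); [by cts|by cts|by cts|].
    by move=> t ->; rewrite subrr; have -> : 2 - 1 = 1 :> R by lra.
  by move=> t ->; rewrite ifT ?subrr//; lra.
have c1 : continuous (fun t : R => Num.min (4 * t) (2 * t + 1)) by cts.
have c2 : continuous (fun t : R => Num.max (2 * t) (4 * t - 1)) by cts.
apply: (@path_homotopic_trans (fun t => F (Num.min (4 * t) (2 * t + 1)))).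
  apply: path_homotopic_eq.
    by apply: continuous_pcat; [exact: continuous_pcat| |rewrite pcat1].
  move=> t t01; rewrite /pcat /F /=.
  by piecewise R.
apply: (@path_homotopic_trans (fun t => F (Num.max (2 * t) (4 * t - 1)))).
  by apply: path_homotopic_reparam => //; split_cases; lra.
apply: path_homotopic_eq; first by cts.
move=> t t01; rewrite /pcat /F /=.
by piecewise R.
Qed.

Lemma pcat1p f : continuous f -> path_homotopic (pcat (cst (f 0)) f) f.
Proof.
move=> cf; apply: (@path_homotopic_trans (fun t => f (Num.max 0 (2 * t - 1)))).
  apply: path_homotopic_eq.
    by apply: continuous_pcat => //; exact: cst_continuous.
  move=> t t01; rewrite /pcat /=.
  by piecewise R.
apply: (path_homotopic_reparam (a' := id)); [by []|by cts|by cts| |];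
  by rewrite /=; split_cases; lra.
Qed.

Lemma pcatp1 f : continuous f -> path_homotopic (pcat f (cst (f 1))) f.
Proof.
move=> cf; apply: (@path_homotopic_trans (fun t => f (Num.min (2 * t) 1))).
  apply: path_homotopic_eq.
    by apply: continuous_pcat => //; exact: cst_continuous.
  move=> t t01; rewrite /pcat /=.
  by piecewise R.
apply: (path_homotopic_reparam (a' := id)); [by []|by cts|by cts| |];
  by rewrite /=; split_cases; lra.
Qed.

(** The path is [f] reparametrized by a hat function vanishing at both ends, and the hat can be
    flattened to 0. *)
Lemma pcatpV f : continuous f -> path_homotopic (pcat f (revp f)) (cst (f 0)).
Proof.
move=> cf.
apply: (@path_homotopic_trans (fun t => f (Num.min (2 * t) (2 - 2 * t)))).
  apply: path_homotopic_eq.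
    by apply: continuous_pcat => //; [exact: continuous_revp|rewrite /revp subr0].
  move=> t t01; rewrite /pcat /revp /=.
  by piecewise R.
apply: (path_homotopic_reparam (a' := fun=> 0)); [by []|by cts|by cts| |];
  by rewrite /=; split_cases; lra.
Qed.

Lemma revpK f : revp (revp f) = f.
Proof. by apply/funext => t; rewrite /revp; congr (f _); ring. Qed.

Lemma pcatVp f : continuous f -> path_homotopic (pcat (revp f) f) (cst (f 1)).
Proof.
move=> cf; have := pcatpV (continuous_revp cf).
by rewrite revpK {2}/revp subr0.
Qed.

End path_homotopy.

Lemma path_homotopic_comp (R : realType) (T T' : topologicalType) (phi : T -> T')
    (f g : R -> T) :
  continuous phi -> path_homotopic f g -> path_homotopic (phi \o f) (phi \o g).
Proof.
move=> cphi [H [cH Hfg Hs]]; exists (phi \o H); split=> /=.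
- exact: continuous_comp_fun.
- by move=> t /Hfg[-> ->].
- by move=> s /Hs[-> ->].
Qed.

Lemma comp_pcat (R : realType) (T T' : topologicalType) (phi : T -> T') (f g : R -> T) :
  phi \o pcat f g = pcat (phi \o f) (phi \o g).
Proof. by apply/funext => t; rewrite /pcat /=; case: ifP. Qed.

(** * The loop space and its path components *)

Lemma unit_itv_compact (R : realType) : compact [set: unit_itv R].
Proof.
have -> : [set: unit_itv R] = clamp @` `[0, 1]%classic.
  apply/seteqP; split=> // t _; exists (val t); last exact: clampK.
  by rewrite /= in_itv /= unit_itvP.
apply: continuous_compact; last exact: segment_compact.
by apply: continuous_subspaceT; exact: continuous_clamp.
Qed.

Section loop_space_topology.
Context {R : realType} {T : uniformType} {p : T}.
Implicit Types (l : loop_space R p) (f g : R -> T).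

Lemma loop_space_nbhsP l (U : set (loop_space R p)) :
  nbhs l U <->
  exists2 E, entourage E & [set l' : loop_space R p | forall t, E (l t, l' t)] `<=` U.
Proof.
split=> [[_ [[A oA <-] Al] AU]|[E entE EU]].
  have /uniform_nbhs[E [entE EA]] :
    nbhs ((l : unit_itv R -> T) : {uniform unit_itv R -> T}) A.
    exact: open_nbhs_nbhs.
  by exists E => // l' El'; apply: AU; apply: EA => t _; exact: El'.
have : nbhs ((l : unit_itv R -> T) : {uniform unit_itv R -> T})
    [set h | forall t, E (l t, h t)].
  by apply/uniform_nbhs; exists E; split=> // h Eh t; exact: Eh.
rewrite nbhsE => -[A [oA Al] AE].
exists ((fun f : loop_space R p => f : unit_itv R -> T) @^-1` A).
by split=> //; [exists A|move=> l' /AE; exact: EU].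
Qed.

Definition loop_of f (fp : is_path p p f) : loop_space R p :=
  let: And3 cf f0 f1 := fp in
  mk_path (continuous_comp_fun continuous_unit_itv_val cf)
    (etrans (congr1 f (clamp_val (introT andP (conj (lexx 0) ler01)))) f0)
    (etrans (congr1 f (clamp_val (introT andP (conj ler01 (lexx 1))))) f1).

Lemma loop_ofE f (fp : is_path p p f) t : loop_of fp t = f (val t).
Proof. by case: fp. Qed.

Definition extend_loop l (t : R) : T := l (clamp t).

Lemma is_path_extend_loop l : is_path p p (extend_loop l).
Proof.
split; [|exact: path_zero|exact: path_one].
by apply: continuous_comp_fun; [exact: continuous_clamp|exact: cts_fun].
Qed.

Lemma loop_of_extend l (lp : is_path p p (extend_loop l)) : loop_of lp = l.
Proof. by apply/path_eqP => t; rewrite loop_ofE /extend_loop clampK. Qed.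

Lemma extend_loop_of f (fp : is_path p p f) t :
  0 <= t <= 1 -> f t = extend_loop (loop_of fp) t.
Proof. by move=> t01; rewrite /extend_loop loop_ofE clamp_val. Qed.

(** From a path of loops, joint continuity follows because closeness in the parameter is uniform
    along the loop. Conversely, compactness of [0, 1] turns joint continuity into this uniform
    closeness. *)
Lemma path_joined_homotopic l l' : path_joined R l l' <->
  path_homotopic (extend_loop l) (extend_loop l').
Proof.
split=> [[G]|[H [cH Hl Hs]]].
  exists (fun z : R * R => G (clamp z.1) (clamp z.2)); split=> /=; first last.
  - by move=> s _; rewrite /extend_loop; split;
      rewrite -?unit_itv0 -?unit_itv1 ?path_zero ?path_one.
  - by move=> t _; split; rewrite -?unit_itv0 -?unit_itv1 ?path_zero ?path_one.
  move=> z; apply/cvg_entourageP => E entE.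
  have cGz : continuous (fun s : R => G (clamp s) : loop_space R p).
    by apply: continuous_comp_fun; [exact: continuous_clamp|exact: cts_fun].
  have cz : continuous (extend_loop (G (clamp z.1))).
    by have [] := is_path_extend_loop (G (clamp z.1)).
  have near1 : \forall s \near z.1, forall t,
      split_ent E (G (clamp z.1) t, G (clamp s) t).
    apply: (cGz z.1 [set l' : loop_space R p | forall t,
      split_ent E (G (clamp z.1) t, l' t)]).
    by apply/loop_space_nbhsP; exists (split_ent E).
  have near2 : \forall t \near z.2,
      split_ent E (G (clamp z.1) (clamp z.2), G (clamp z.1) (clamp t)).
    have /cvg_entourageP := cz z.2.
    by apply.
  exists ([set s | forall t, split_ent E (G (clamp z.1) t, G (clamp s) t)],
    [set t | split_ent E (G (clamp z.1) (clamp z.2), G (clamp z.1) (clamp t))]).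
    by [].
  move=> [s t] /= [h1 h2]; apply: (entourage_split (G (clamp z.1) (clamp t))) => //.
have Hp s : is_path p p (fun t => H (clampr s, t)).
  have [Hs0 Hs1] := Hs _ (clampr01 s).
  have [_ l0 l1] := is_path_extend_loop l.
  by split; [cts|rewrite Hs0|rewrite Hs1].
apply: (@path_joined_of _ _ _ _ (fun s => loop_of (Hp (val s)))).
- move=> s U /loop_space_nbhsP[E entE EU].
  have cK : continuous (fun z : R * R => H (clampr z.1, z.2)) by cts.
  have := @unit_itv_compact R => /compact_near_coveringP.
  move=> /(_ _ (nbhs s)
    (fun s' t => E (H (clampr (val s), val t), H (clampr (val s'), val t))) _).
  have near_t (t : unit_itv R) : [set: unit_itv R] t ->
    \forall t' \near t & s' \near s,
      E (H (clampr (val s), val t'), H (clampr (val s'), val t')).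
    move=> _.
    have cKI : continuous (fun z : unit_itv R * unit_itv R =>
        H (clampr (val z.1), val z.2)).
      apply: (continuous_comp_fun _ cH); apply: continuous_pair_fun.
        apply: continuous_comp_fun; last exact: continuous_clampr.
        by apply: continuous_comp_fun; last exact: continuous_unit_itv_val;
          move=> ?; exact: cvg_fst.
      by apply: continuous_comp_fun; last exact: continuous_unit_itv_val;
          move=> ?; exact: cvg_snd.
    have entE' := entourage_inv (entourage_split_ent entE).
    have /cvg_entourageP/(_ _ (entourage_split_ent entE)) := cKI (s, t).
    have /cvg_entourageP/(_ _ entE') := cKI (s, t).
    move=> [[A1 A2] /= [sA1 tA2] A12] [[B1 B2] /= [sB1 tB2] B12].
    exists (A2 `&` B2, A1 `&` B1); first by split; exact: filterI.
    move=> [t' s'] /= [[A2t B2t] [A1s B1s]].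
    apply: (entourage_split (H (clampr (val s), val t))) => //.
      by apply: (A12 (s, t')); split=> //; exact: nbhs_singleton.
    exact: (B12 (s', t')).
  move=> /(_ near_t); apply: filterS => s' Es'; apply: EU => t.
  by rewrite !loop_ofE; exact: Es'.
- have z01 : 0 <= (0 : R) <= 1 by lra.
  apply/path_eqP => t; rewrite loop_ofE unit_itv0 clamp_val// clampr_id//.
  by have [-> _] := Hl _ (unit_itvP t); rewrite /extend_loop clampK.
- have o01 : 0 <= (1 : R) <= 1 by lra.
  apply/path_eqP => t; rewrite loop_ofE unit_itv1 clamp_val// clampr_id//.
  by have [_ ->] := Hl _ (unit_itvP t); rewrite /extend_loop clampK.
Qed.

Lemma pi1_eqP l l' :
  \pi_(pi1 R p) l = \pi_(pi1 R p) l' <->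
  path_homotopic (extend_loop l) (extend_loop l').
Proof.
rewrite -path_joined_homotopic; split=> [/eqmodP/asboolP//|ll'].
exact/eqmodP/asboolP.
Qed.

End loop_space_topology.

Section loop_class.
Context {R : realType} {T : uniformType} (p : T).
Implicit Types f g : R -> T.

(* Functions that are not loops at [p] get the class of the constant loop. *)
Definition loop_class f : pi1 R p :=
  if pselect (is_path p p f) is left fp then \pi_(pi1 R p) (loop_of fp)
  else \pi_(pi1 R p) (loop_of (is_path_cst p)).

Lemma loop_classE f (fp : is_path p p f) : loop_class f = \pi_(pi1 R p) (loop_of fp).
Proof.
by rewrite /loop_class; case: pselect => // fp'; rewrite (Prop_irrelevance fp fp').
Qed.

Lemma loop_class_eqP f g : is_path p p f -> is_path p p g ->
  loop_class f = loop_class g <-> path_homotopic f g.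
Proof.
move=> fp gp; rewrite (loop_classE fp) (loop_classE gp) pi1_eqP.
have ff : path_homotopic f (extend_loop (loop_of fp)).
  by apply: path_homotopic_eq; [case: fp|exact: extend_loop_of].
have gg : path_homotopic g (extend_loop (loop_of gp)).
  by apply: path_homotopic_eq; [case: gp|exact: extend_loop_of].
split=> h.
  apply: path_homotopic_trans ff _.
  by apply: path_homotopic_trans h _; exact: path_homotopic_sym.
apply: (path_homotopic_trans (path_homotopic_sym ff)).
exact: path_homotopic_trans h gg.
Qed.

Lemma loop_class_extend (l : loop_space R p) : loop_class (extend_loop l) = \pi_(pi1 R p) l.
Proof. by rewrite (loop_classE (is_path_extend_loop l)) loop_of_extend. Qed.

Lemma loop_class_surj (u : pi1 R p) : exists2 f, is_path p p f & u = loop_class f.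
Proof.
exists (extend_loop (repr u)); first exact: is_path_extend_loop.
by rewrite loop_class_extend reprK.
Qed.

End loop_class.

(** * The group structure *)

Section group_structure.
Context {R : realType} {T : uniformType} (p : T).
Implicit Types (f g h : R -> T) (u v w : pi1 R p).

Lemma path_homotopic_repr f : is_path p p f ->
  path_homotopic (extend_loop (repr (loop_class p f))) f.
Proof.
move=> fp; have ep := is_path_extend_loop (repr (loop_class p f)).
by apply/(loop_class_eqP ep fp); rewrite loop_class_extend reprK.
Qed.

Definition pi1_one : pi1 R p := loop_class p (cst p).
Definition pi1_mul u v : pi1 R p :=
  loop_class p (pcat (extend_loop (repr u)) (extend_loop (repr v))).
Definition pi1_inv u : pi1 R p := loop_class p (revp (extend_loop (repr u))).

Lemma pi1_mulE f g : is_path p p f -> is_path p p g ->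
  pi1_mul (loop_class p f) (loop_class p g) = loop_class p (pcat f g).
Proof.
move=> fp gp; apply/loop_class_eqP.
- by apply: is_path_pcat; exact: is_path_extend_loop.
- exact: is_path_pcat fp gp.
- have [_ _ e1] := is_path_extend_loop (repr (loop_class p f)).
  have [_ e0 _] := is_path_extend_loop (repr (loop_class p g)).
  by apply: path_homotopic_pcat; [by rewrite e1 e0|..]; exact: path_homotopic_repr.
Qed.

Lemma pi1_invE f : is_path p p f ->
  pi1_inv (loop_class p f) = loop_class p (revp f).
Proof.
move=> fp; apply/loop_class_eqP.
- by apply: is_path_revp; exact: is_path_extend_loop.
- exact: is_path_revp.
- by apply: path_homotopic_revp; exact: path_homotopic_repr.
Qed.

Lemma pi1_mulA : associative pi1_mul.
Proof.
move=> u v w; have [f fp ->] := loop_class_surj u.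
have [g gp ->] := loop_class_surj v; have [h hp ->] := loop_class_surj w.
have fgp := is_path_pcat fp gp; have ghp := is_path_pcat gp hp.
rewrite !pi1_mulE//; apply/loop_class_eqP; [exact: is_path_pcat fp _|
  exact: is_path_pcat fgp _|].
apply: path_homotopic_sym.
move: fp gp hp => [cf f0 f1] [cg g0 g1] [ch h0 h1].
by apply: pcatA => //; rewrite ?f1 ?g1.
Qed.

Lemma pi1_mul1 : left_id pi1_one pi1_mul.
Proof.
move=> u; have [f fp ->] := loop_class_surj u.
have cp : is_path p p (cst p : R -> T) by exact: is_path_cst.
rewrite pi1_mulE//; apply/loop_class_eqP => //; first exact: is_path_pcat cp fp.
by move: fp => [cf <- _]; exact: pcat1p.
Qed.

Lemma pi1_mulr1 : right_id pi1_one pi1_mul.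
Proof.
move=> u; have [f fp ->] := loop_class_surj u.
have cp : is_path p p (cst p : R -> T) by exact: is_path_cst.
rewrite pi1_mulE//; apply/loop_class_eqP => //; first exact: is_path_pcat fp cp.
by move: fp => [cf _ <-]; exact: pcatp1.
Qed.

Lemma pi1_mulV : left_inverse pi1_one pi1_inv pi1_mul.
Proof.
move=> u; have [f fp ->] := loop_class_surj u.
have fVp := is_path_revp fp.
rewrite pi1_invE// pi1_mulE//; apply/loop_class_eqP;
  [exact: is_path_pcat fVp fp|exact: is_path_cst|].
by move: fp => [cf _ <-]; exact: pcatVp.
Qed.

Lemma pi1_mulrV : right_inverse pi1_one pi1_inv pi1_mul.
Proof.
move=> u; have [f fp ->] := loop_class_surj u.
have fVp := is_path_revp fp.
rewrite pi1_invE// pi1_mulE//; apply/loop_class_eqP;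
  [exact: is_path_pcat fp fVp|exact: is_path_cst|].
by move: fp => [cf <- _]; exact: pcatpV.
Qed.

HB.instance Definition _ := isGroup.Build (pi1 R p)
  pi1_mulA pi1_mul1 pi1_mulr1 pi1_mulV pi1_mulrV.

Lemma loop_classM f g : is_path p p f -> is_path p p g ->
  loop_class p (pcat f g) = (loop_class p f * loop_class p g)%g.
Proof. by move=> fp gp; rewrite -pi1_mulE. Qed.

Lemma loop_classV f : is_path p p f ->
  loop_class p (revp f) = (loop_class p f)^-1%g.
Proof. by move=> fp; rewrite -pi1_invE. Qed.

Lemma loop_class1 : loop_class p (cst p) = 1%g.
Proof. by []. Qed.

End group_structure.

(** * Closing paths up along connecting paths *)

Section conjugation.
Context {R : realType} {T : topologicalType}.
Implicit Types (f g s : R -> T).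

(** The tails [s] and [s'] may differ, so that a path between two arbitrary points, and not only a
    loop, becomes a loop at the base point. *)
Definition pconj s f s' : R -> T := pcat s (pcat f (revp s')).

Lemma is_path_pconj (p x y : T) s f s' :
  is_path p x s -> is_path x y f -> is_path p y s' -> is_path p p (pconj s f s').
Proof.
by move=> sp fp sp'; apply: (is_path_pcat sp); apply: (is_path_pcat fp);
  exact: is_path_revp.
Qed.

Lemma path_homotopic_pconj (p x y : T) s f g s' :
  is_path p x s -> is_path x y f -> is_path p y s' ->
  path_homotopic f g -> path_homotopic (pconj s f s') (pconj s g s').
Proof.
move=> [cs s0 s1] [cf f0 f1] [cs' s0' s1'] fg.
apply: path_homotopic_pcat; first by rewrite pcat0 s1.
  exact: path_homotopic_refl.
apply: path_homotopic_pcat => //; first by rewrite f1 /revp subr0.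
by apply: path_homotopic_refl; exact: continuous_revp.
Qed.

(** After reassociation, the return along [s'] cancels against the departure along [s']. *)
Lemma pcat_pconj (p x y z : T) s f s' g s'' :
  is_path p x s -> is_path x y f -> is_path p y s' -> is_path y z g ->
  is_path p z s'' ->
  path_homotopic (pcat (pconj s f s') (pconj s' g s'')) (pconj s (pcat f g) s'').
Proof.
move=> ps pf ps' pg ps''.
have psV' := is_path_revp ps'; have psV'' := is_path_revp ps''.
have pM := is_path_pcat pg psV''; have pK := is_path_pcat ps' pM.
have pfs := is_path_pcat pf psV'.
move: (ps) (pf) (ps') (pg) (psV') (psV'') (pM) (pK) (pfs).
move=> [cs s0 s1] [cf f0 f1] [cs' s0' s1'] [cg g0 g1] [csV' sV0' sV1'].
move=> [csV'' sV0'' sV1''] [cM M0 M1] [cK K0 K1] [cfs fs0 fs1].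
apply: (path_homotopic_trans (pcatA cs cfs cK _ _)); rewrite ?s1 ?fs1//.
apply: path_homotopic_pcat; first by rewrite s1 pcat0.
  exact: path_homotopic_refl.
apply: (path_homotopic_trans (pcatA cf csV' cK _ _)); rewrite ?f1 ?sV1'//.
apply: (@path_homotopic_trans _ _ (pcat f (pcat g (revp s'')))); last first.
  by apply/path_homotopic_sym/pcatA => //; rewrite ?f1 ?g1.
apply: path_homotopic_pcat; first by rewrite f1 pcat0.
  exact: path_homotopic_refl.
apply: (path_homotopic_trans (path_homotopic_sym (pcatA csV' cs' cM _ _)));
  rewrite ?sV1' ?s1'//.
apply: (path_homotopic_trans _ (pcat1p cM)).
apply: path_homotopic_pcat; first by rewrite pcat1 s1'.
  by rewrite M0 -s1'; exact: pcatVp.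
exact: path_homotopic_refl.
Qed.

Lemma pconj_cst (p : T) f :
  is_path p p f -> path_homotopic (pconj (cst p) f (cst p)) f.
Proof.
move=> [cf f0 f1].
have pV : revp (cst p) = cst p :> (R -> T) by [].
rewrite /pconj pV.
have cp : continuous (cst p : R -> T) by exact: cst_continuous.
have ff1 : path_homotopic (pcat f (cst p)) f by rewrite -f1; exact: pcatp1.
apply: (@path_homotopic_trans _ _ (pcat (cst p) f)); last first.
  by rewrite -f0; exact: pcat1p.
apply: path_homotopic_pcat => //; first by rewrite pcat0.
exact: path_homotopic_refl.
Qed.

Lemma pconjK (x y : T) s f : is_path x y s -> is_path y y f ->
  path_homotopic (pconj (revp s) (pconj s f s) (revp s)) f.
Proof.
move=> ps pf; have psV := is_path_revp ps.
have pfV := is_path_pcat pf psV; have pfVs := is_path_pcat pfV ps.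
move: (ps) (pf) (psV) (pfV) (pfVs).
move=> [cs s0 s1] [cf f0 f1] [csV sV0 sV1] [cfV fV0 fV1] [cfVs fVs0 fVs1].
rewrite {1}/pconj revpK.
apply: (@path_homotopic_trans _ _ (pcat (revp s) (pcat s (pcat (pcat f (revp s)) s)))).
  apply: path_homotopic_pcat; first by rewrite sV1 pcat0 /pconj pcat0.
    exact: path_homotopic_refl.
  by apply: pcatA => //; rewrite ?s1 ?fV1.
apply: (path_homotopic_trans (path_homotopic_sym (pcatA csV cs cfVs _ _)));
  rewrite ?sV1 ?s1//.
apply: (@path_homotopic_trans _ _ (pcat (cst y) (pcat (pcat f (revp s)) s))).
  apply: path_homotopic_pcat; first by rewrite pcat1 s1.
    by rewrite -s1; exact: pcatVp.
  exact: path_homotopic_refl.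
apply: (@path_homotopic_trans _ _ (pcat (pcat f (revp s)) s)).
  by rewrite -fVs0; exact: pcat1p.
apply: (path_homotopic_trans (pcatA cf csV cs _ _)); rewrite ?f1 ?sV1//.
apply: (@path_homotopic_trans _ _ (pcat f (cst y))); last first.
  by rewrite -f1; exact: pcatp1.
apply: path_homotopic_pcat; first by rewrite f1 pcat0.
  exact: path_homotopic_refl.
by rewrite -s1; exact: pcatVp.
Qed.

End conjugation.

(** * Multiplicative classes of open paths *)

Section cocycle.
Context {R : realType} {T : uniformType} (p : T) (sigma : T -> R -> T).
Hypothesis sigmaP : forall x, is_path p x (sigma x).
Implicit Types (f g : R -> T).

(* Closing paths up along [sigma] makes path classes multiplicative under
   concatenation, whatever their end points. *)
Definition closed_class f : pi1 R p :=
  loop_class p (pconj (sigma (f 0)) f (sigma (f 1))).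

Lemma is_path_ends f : continuous f -> is_path (f 0) (f 1) f.
Proof. by []. Qed.

Lemma closed_class_homotopic f g : continuous f -> continuous g ->
  path_homotopic f g -> closed_class f = closed_class g.
Proof.
move=> cf cg fg; have [f0 f1] := path_homotopic_ends fg.
have pf := is_path_ends cf; have pg := is_path_ends cg.
rewrite /closed_class -f0 -f1 in pg *; apply/loop_class_eqP.
- exact: is_path_pconj (sigmaP _) pf (sigmaP _).
- exact: is_path_pconj (sigmaP _) pg (sigmaP _).
- exact: path_homotopic_pconj (sigmaP _) pf (sigmaP _) fg.
Qed.

Lemma closed_class_pcat f g : continuous f -> continuous g -> f 1 = g 0 ->
  closed_class (pcat f g) = (closed_class f * closed_class g)%g.
Proof.
move=> cf cg fg.
have pf := is_path_ends cf; have pg := is_path_ends cg; rewrite -fg in pg.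
rewrite /closed_class -loop_classM ?pcat0 ?pcat1 -?fg.
- apply/esym/loop_class_eqP.
  + exact: is_path_pcat (is_path_pconj (sigmaP _) pf (sigmaP _))
      (is_path_pconj (sigmaP _) pg (sigmaP _)).
  + exact: is_path_pconj (sigmaP _) (is_path_pcat pf pg) (sigmaP _).
  + exact: pcat_pconj (sigmaP _) pf (sigmaP _) pg (sigmaP _).
- exact: is_path_pconj (sigmaP _) pf (sigmaP _).
- exact: is_path_pconj (sigmaP _) pg (sigmaP _).
Qed.

Lemma closed_class_loop f : sigma p = cst p -> is_path p p f ->
  closed_class f = loop_class p f.
Proof.
move=> sp fp; rewrite /closed_class; have [_ -> ->] := fp; rewrite sp.
apply/loop_class_eqP => //; last exact: pconj_cst.
exact: is_path_pconj (is_path_cst p) fp (is_path_cst p).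
Qed.

End cocycle.

(** * Induced maps and change of base point *)

Section pi1_map.
Context {R : realType} {T T' : uniformType} (p : T) (p' : T').
Variable Phi : (R -> T) -> (R -> T').

(** [Phi] acts on paths rather than points, so that both composition with a map of spaces and
    conjugation by a path are covered. *)
Definition pi1_map (u : pi1 R p) : pi1 R p' :=
  loop_class p' (Phi (extend_loop (repr u))).

Hypothesis Phi_path : forall f, is_path p p f -> is_path p' p' (Phi f).
Hypothesis Phi_homotopic : forall f g, is_path p p f -> is_path p p g ->
  path_homotopic f g -> path_homotopic (Phi f) (Phi g).

Lemma pi1_mapE f : is_path p p f -> pi1_map (loop_class p f) = loop_class p' (Phi f).
Proof.
move=> fp; have ep := is_path_extend_loop (repr (loop_class p f)).
apply/loop_class_eqP; [exact: Phi_path|exact: Phi_path|].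
by apply: Phi_homotopic => //; exact: path_homotopic_repr.
Qed.

Hypothesis Phi_continuous : forall (l : loop_space R p) E, entourage E ->
  \forall l' \near l, forall t : R, 0 <= t <= 1 ->
    E (Phi (extend_loop l) t, Phi (extend_loop l') t).

Lemma continuous_pi1_map : continuous pi1_map.
Proof.
pose F (l : loop_space R p) : loop_space R p' :=
  loop_of (Phi_path (is_path_extend_loop l)).
have cF : continuous F.
  move=> l U /loop_space_nbhsP[E entE EU].
  have := Phi_continuous l entE; apply: filterS => l' El'.
  by apply: EU => t; rewrite !loop_ofE; apply: El'; exact: unit_itvP.
have FE : pi1_map \o \pi_(pi1 R p) = \pi_(pi1 R p') \o F.
  apply/funext => l /=; rewrite -loop_class_extend pi1_mapE.
    by rewrite (loop_classE (Phi_path (is_path_extend_loop l))).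
  exact: is_path_extend_loop.
apply/quotient_continuous; rewrite FE.
by apply: continuous_comp_fun cF _; exact: pi_continuous.
Qed.

End pi1_map.

Section induced_map.
Context {R : realType} {T T' : uniformType} (p : T) (p' : T') (phi : T -> T').
Hypotheses (cphi : continuous phi) (phip : phi p = p').

Definition pi1_induced : pi1 R p -> pi1 R p' := pi1_map p' (fun f => phi \o f).

Lemma is_path_comp f : is_path p p f -> is_path p' p' (phi \o f : R -> T').
Proof.
by move=> [cf f0 f1]; split; [exact: continuous_comp_fun|
  rewrite /= f0|rewrite /= f1].
Qed.

Lemma pi1_inducedE f : is_path p p f ->
  pi1_induced (loop_class p f) = loop_class p' (phi \o f).
Proof.
move=> fp; apply: (pi1_mapE (Phi := fun f => phi \o f)) fp => [g|g h _ _].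
  exact: is_path_comp.
exact: path_homotopic_comp.
Qed.

(* Uniform continuity of [phi] fails in general; compactness of [0, 1] gives it
   along the loop [l]. *)
Lemma continuous_pi1_induced : continuous pi1_induced.
Proof.
apply: continuous_pi1_map => [f|f g _ _|l E entE].
- exact: is_path_comp.
- exact: path_homotopic_comp.
have := @unit_itv_compact R => /compact_near_coveringP.
move=> /(_ _ (nbhs l) (fun (l' : loop_space R p) t => E (phi (l t), phi (l' t))) _) /=.
have near_t (t : unit_itv R) : [set: unit_itv R] t ->
    \forall t' \near t & l' \near l, E (phi (l t'), phi ((l' : loop_space R p) t')).
  move=> _.
  pose E' := split_ent E `&` (split_ent E)^-1%relation.
  have entE' : entourage E'.
    have entE2 : entourage (split_ent E) by exact: entourage_split_ent.
    exact: filterI entE2 (entourage_inv entE2).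
  have := cphi (x := l t) => /cvg_entourageP/(_ _ entE').
  rewrite -nbhs_entourageE => -[D entD Dphi].
  have nt : \forall t' \near t, split_ent D (l t, l t').
    have cl : continuous l by exact: cts_fun.
    have : nbhs t (l @^-1` xsection (split_ent D) (l t)) :=
      cl t _ (nbhs_entourage (l t) (entourage_split_ent entD)).
    by apply: filterS => t' /= /xsectionP.
  have nl : \forall l' \near l, forall t, split_ent D (l t, (l' : loop_space R p) t).
    by apply/loop_space_nbhsP; exists (split_ent D).
  exists ([set t' | split_ent D (l t, l t')],
    [set l' : loop_space R p | forall t, split_ent D (l t, l' t)]) => //.
  move=> [t' l'] /= [h1 h2].
  have h : D (l t, l t').
    by apply: (entourage_split (l t')) => //; exact: entourage_refl.
  have h' : D (l t, l' t') by apply: (entourage_split (l t')).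
  have [_ k] : E' (phi (l t), phi (l t')) by apply: Dphi; exact/xsectionP.
  have [k' _] : E' (phi (l t), phi (l' t')) by apply: Dphi; exact/xsectionP.
  exact: (entourage_split (phi (l t))).
move=> /(_ near_t); apply: filterS => l' El' t _; exact: El'.
Qed.

End induced_map.

(** * Complete metrizability under change of base point *)

Lemma completely_metrizable_homeo (R : realType) (S T : topologicalType)
    (h : S -> T) (g : T -> S) :
  continuous h -> continuous g -> cancel h g -> cancel g h ->
  completely_metrizable R T -> completely_metrizable R S.
Proof.
move=> ch cg hK gK [d [[d0 deq dsym dtri] dn dc]].
exists (fun x y => d (h x) (h y)); split.
- split=> // x y; split=> [/deq/(can_inj hK)//|->]; exact/deq.
- move=> x U; split.
    move=> xU; have : nbhs (h x) (g @^-1` U) by apply: cg; rewrite hK.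
    by move=> /dn[e e0 eU]; exists e => // y /= /eU /=; rewrite hK.
  move=> [e e0 eU]; apply: (filterS eU).
  by apply: (ch x [set z | d (h x) z < e]); apply/dn; exists e.
- move=> u /dc[l ul]; exists (g l).
  have -> : u = g \o (h \o u) by apply/funext => n /=; rewrite hK.
  by apply: cvg_comp ul _; exact: cg.
Qed.

(** Conjugation by a path is a homeomorphism of fundamental groups: the tails are the same for all
    loops, so uniformly close loops stay uniformly close, and [pconjK] provides the inverse. *)
Lemma completely_metrizable_base_change (R : realType) (T : uniformType) (x y : T) :
  path_joined R x y ->
  completely_metrizable R (pi1 R x) -> completely_metrizable R (pi1 R y).
Proof.
move=> [G].
pose s : R -> T := fun t => G (clamp t).
have ps : is_path x y s.
  split; [|exact: path_zero|exact: path_one].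
  by apply: continuous_comp_fun; [exact: continuous_clamp|exact: cts_fun].
have psV := is_path_revp ps.
have Ppath z w (r : R -> T) (pr : is_path z w r) f :
    is_path w w f -> is_path z z (pconj r f r).
  by move=> pf; exact: (is_path_pconj pr pf pr).
have Phom z w (r : R -> T) (pr : is_path z w r) f g :
    is_path w w f -> is_path w w g ->
    path_homotopic f g -> path_homotopic (pconj r f r) (pconj r g r).
  by move=> pf pg; exact: (path_homotopic_pconj pr pf pr).
have Pcont z w (r : R -> T) (pr : is_path z w r) :
    continuous (pi1_map (p := w) z (fun f => pconj r f r)).
  apply: continuous_pi1_map; [exact: (Ppath _ _ _ pr)|exact: (Phom _ _ _ pr)|].
  move=> l E entE; apply/loop_space_nbhsP; exists E => // l' El' t _.
  rewrite /pconj /pcat; case: ifP => _; first exact: entourage_refl.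
  by case: ifP => _; [exact: El'|exact: entourage_refl].
apply: (completely_metrizable_homeo (Pcont _ _ _ ps) (Pcont _ _ _ psV)).
- move=> u; have [f pf ->] := loop_class_surj u.
  have pf' := Ppath _ _ _ ps _ pf; have pf'' := Ppath _ _ _ psV _ pf'.
  rewrite (pi1_mapE (Ppath _ _ _ ps) (Phom _ _ _ ps))//.
  rewrite (pi1_mapE (Ppath _ _ _ psV) (Phom _ _ _ psV))//.
  by apply/loop_class_eqP => //; exact: pconjK ps pf.
- move=> u; have [f pf ->] := loop_class_surj u.
  have pf' := Ppath _ _ _ psV _ pf; have pf'' := Ppath _ _ _ ps _ pf'.
  rewrite (pi1_mapE (Ppath _ _ _ psV) (Phom _ _ _ psV))//.
  rewrite (pi1_mapE (Ppath _ _ _ ps) (Phom _ _ _ ps))//.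
  by apply/loop_class_eqP => //; have := pconjK psV pf; rewrite revpK.
Qed.

(** * Normal forms in a free product *)

Section free_product.
Context {G : groupType}.
Implicit Types (s : seq (bool * G)) (c : bool) (g h : G).
Local Open Scope group_scope.

(* Normal forms of elements of the free product of two copies of [G], the
   first letter of the list being the last syllable. *)
Definition reduced s :=
  all (fun x => x.2 != 1) s && sorted (fun x y => x.1 != y.1) s.

(** Right multiplication of a reduced word by the letter [g] of the factor [c]. Following van der
    Waerden, the factors act on reduced words, so no group law on words has to be built. *)
Definition push c g s :=
  if g == 1 then s else
  if s is (d, h) :: s' then
    if d == c then (if h * g == 1 then s' else (c, h * g) :: s')
    else (c, g) :: s
  else [:: (c, g)].

Lemma reduced_behead x s : reduced (x :: s) -> reduced s.
Proof.
rewrite /reduced /= => /andP[/andP[_ ->]] /=.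
by case: s => //= y s /andP[].
Qed.

Lemma push1 c s : push c 1 s = s.
Proof. by rewrite /push eqxx. Qed.

Lemma reduced_push c g s : reduced s -> reduced (push c g s).
Proof.
rewrite /push; have [//|g1] := eqVneq g 1.
case: s => [|[d h] s rs]; first by rewrite /reduced /= g1.
have rs' := reduced_behead rs.
have [dc|dc] := eqVneq d c; last first.
  by move: rs; rewrite /reduced /= g1 (eq_sym c d) dc.
have [//|hg] := eqVneq (h * g) 1.
by move: rs; rewrite /reduced /= hg -dc => /andP[/andP[_ ->]]; case: (s).
Qed.

(** Reducedness enters in two ways: the syllable exposed by a cancellation belongs to the other
    factor, and no syllable is trivial. *)
Lemma pushM c g h s : reduced s -> push c (g * h) s = push c h (push c g s).
Proof.
have [->|g1] := eqVneq g 1; first by rewrite mul1g push1.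
have [->|h1] := eqVneq h 1; first by rewrite mulg1 push1.
rewrite {1 3}/push (negPf g1).
case: s => [_|[d k] s rs].
  have [gh|gh] := eqVneq (g * h) 1; first by rewrite /push (negPf h1) eqxx gh eqxx.
  by rewrite /push (negPf h1) eqxx (negPf gh).
have [dc|dc] := eqVneq d c; last first.
  rewrite /push (negPf h1) eqxx; have [//|//] := eqVneq (g * h) 1.
have [kg|kg] := eqVneq (k * g) 1.
  have kgh : k * (g * h) = h by rewrite mulgA kg mul1g.
  rewrite kgh (negPf h1).
  have gk : g = k^-1 by rewrite -(mulKg k g) kg mulg1.
  have [gh|gh] := eqVneq (g * h) 1.
    have -> : k = h by apply: (mulgI g); rewrite gh gk mulVg.
    rewrite /push (negPf h1); case: s rs => [|[e l] s]; first by rewrite dc.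
    by rewrite dc /reduced /= => /and3P[_ ce _]; rewrite eq_sym (negPf ce).
  rewrite /push (negPf h1); case: s rs => [//|[e l] s].
  by rewrite dc /reduced /= => /and3P[_ ce _]; rewrite eq_sym (negPf ce).
rewrite /push (negPf h1) eqxx mulgA.
have [gh|gh] := eqVneq (g * h) 1; last by [].
have -> : k * g * h = k by rewrite -mulgA gh mulg1.
by move: rs; rewrite /reduced /= dc => /andP[/andP[/negPf -> _] _].
Qed.

Lemma size_push c g s : (size (push c g s) <= (size s).+1)%N.
Proof.
rewrite /push; case: eqP => // _; case: s => [//|[d h] s].
by case: eqP => // _; case: eqP => //= _; rewrite ltnW.
Qed.

End free_product.

(** * Syllables of a loop in a wedge *)

Section subdivision.
Context {R : realType} {X : metricType R}.
Implicit Types (f : R -> X) (H : R * R -> X) (P : (R * R -> X) -> Prop).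

Definition half (i : R) f (t : R) : X := f ((t + i) / 2).

Definition quarter (i j : R) H (z : R * R) : X := H ((z.1 + i) / 2, (z.2 + j) / 2).

Fixpoint subdivided P m H : Prop :=
  if m is m'.+1 then
    [/\ subdivided P m' (quarter 0 0 H), subdivided P m' (quarter 0 1 H),
        subdivided P m' (quarter 1 0 H) & subdivided P m' (quarter 1 1 H)]
  else P H.

Definition unit_square (z : R * R) : Prop := 0 <= z.1 <= 1 /\ 0 <= z.2 <= 1.

Lemma continuous_half i f : continuous f -> continuous (half i f).
Proof. by move=> cf; rewrite /half; cts. Qed.

Lemma continuous_quarter i j H : continuous H -> continuous (quarter i j H).
Proof. by move=> cH; rewrite /quarter; cts. Qed.

Lemma subdivided_comp (phi : X -> X) P Q m H :
  (forall K, P (phi \o K) -> Q K) ->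
  subdivided P m (phi \o H) -> subdivided Q m H.
Proof.
by move=> PQ; elim: m H => [|m IH] H /=; [exact: PQ|case=> *; split; exact: IH].
Qed.

Lemma square_uniformly_continuous H (e : R) : continuous H -> 0 < e ->
  exists2 d : R, 0 < d & forall z w, unit_square z -> unit_square w ->
    `|z.1 - w.1| < d -> `|z.2 - w.2| < d -> mdist (H z) (H w) < e.
Proof.
move=> cH e0.
have cK : compact (`[0 : R, 1]%classic `*` `[0 : R, 1]%classic).
  by apply: compact_setX; exact: segment_compact.
move/compact_near_coveringP : cK.
move=> /(_ R (0 : R)^'+ (fun d z => forall w : R * R,
  `|z.1 - w.1| < d -> `|z.2 - w.2| < d -> mdist (H z) (H w) < e) _).
have near_z (z : R * R) : (`[0 : R, 1]%classic `*` `[0 : R, 1]%classic) z ->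
  \forall z' \near z & d \near (0 : R)^'+, forall w : R * R,
    `|z'.1 - w.1| < d -> `|z'.2 - w.2| < d -> mdist (H z') (H w) < e.
  move=> _.
  have e2 : 0 < e / 2 by rewrite divr_gt0.
  have : \forall y \near z, ball (H z) (e / 2) (H y).
    by apply: (cH z (ball (H z) (e / 2))); exact: nbhsx_ballx.
  move=> /nbhs_ballP[r /= r0 rH].
  have r2 : 0 < r / 2 by rewrite divr_gt0.
  exists (ball z (r / 2), [set d | d < r / 2]).
    by split => /=; [exact: nbhsx_ballx|exact: nbhs_right_lt].
  move=> [z' d] /= [[z1 z2] dr] w w1 w2.
  have Hz' : ball (H z) (e / 2) (H z').
    by apply: rH; split; apply: (le_ball _ _); [|exact: z1| |exact: z2]; lra.
  have Hw : ball (H z) (e / 2) (H w).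
    apply: rH; split.
      have -> : r = r / 2 + r / 2 by lra.
      by apply: (ball_triangle z1); rewrite /ball /= (lt_trans w1).
    have -> : r = r / 2 + r / 2 by lra.
    by apply: (ball_triangle z2); rewrite /ball /= (lt_trans w2).
  have := ball_triangle (ball_sym Hz') Hw.
  by rewrite ballEmdist /= -splitr.
move=> /(_ near_z) => near_d.
near ((0 : R)^'+) => d.
exists d; first by near: d; exact: nbhs_right_gt.
move=> z w [z1 z2] _ zw1 zw2; move: z w z1 z2 zw1 zw2.
suff: `[0 : R, 1]%classic `*` `[0 : R, 1]%classic `<=` [set z | forall w : R * R,
    `|z.1 - w.1| < d -> `|z.2 - w.2| < d -> mdist (H z) (H w) < e].
  by move=> h z w z1 z2; apply: h; split; rewrite /= in_itv.
by near: d; exact: near_d.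
Unshelve. all: by end_near. Qed.

Lemma subdivided_small H (e : R) : continuous H -> 0 < e ->
  exists m, subdivided (fun K => forall z w, unit_square z -> unit_square w ->
    mdist (K z) (K w) < e) m H.
Proof.
move=> cH e0; have [d d0 dH] := square_uniformly_continuous cH e0.
have [m dm] : exists m, 1 < 2 ^+ m * d.
  have [m md] : exists m : nat, d^-1 < m%:R.
    by exists (Num.trunc d^-1).+1; exact: truncnS_gt.
  exists m; rewrite -ltr_pdivrMr// div1r (lt_le_trans md)//.
  by rewrite -natrX ler_nat ltnW// ltn_expl.
(* The modulus doubles with each quartering, which preserves the inequality [dm]. At depth 0 the
   modulus exceeds 1, the side of the square. *)
exists m; elim: m H d {cH} d0 dH dm => [|m IH] H d d0 dH dm /=.
  move=> z w z1 w1; apply: dH => //; move: z1 w1 dm => [? ?] [? ?];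
    rewrite expr0 mul1r => dm; by rewrite ltr_norml; lra.
have quarter_d (i j : R) : 0 <= i <= 1 -> 0 <= j <= 1 ->
    forall z w, unit_square z -> unit_square w ->
    `|z.1 - w.1| < 2 * d -> `|z.2 - w.2| < 2 * d ->
    mdist (quarter i j H z) (quarter i j H w) < e.
  move=> i01 j01 z w [z1 z2] [w1 w2].
  rewrite !ltr_norml => zw1 zw2.
  by apply: dH; rewrite /unit_square /= ?ltr_norml; lra.
have dm' : 1 < 2 ^+ m * (2 * d) by rewrite mulrA -exprSr.
have d20 : 0 < 2 * d by rewrite mulr_gt0.
by split; apply: (IH _ (2 * d)) => //; apply: quarter_d; lra.
Qed.

End subdivision.

(** * The action of loops on reduced words *)

Section word_action.
Context {R : realType} {X : metricType R} (p : X).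
Variables (sigma : X -> R -> X) (rho : bool -> X -> X) (V : bool -> set X).
Hypothesis sigmaP : forall x, is_path p x (sigma x).
Hypothesis rho_continuous : forall c, continuous (rho c).
Hypothesis rho_wedge : forall x, rho true x <> p -> rho false x = p.
Hypothesis rho_p : forall c, rho c p = p.
Hypothesis Vp : forall c, V c p.
Hypothesis closed_class_V : forall c (g : R -> X), continuous g ->
  (forall t, 0 <= t <= 1 -> V c (g t)) -> closed_class p sigma g = 1%g.
Implicit Types (f : R -> X) (H : R * R -> X) (s : seq (bool * pi1 R p)).

Local Notation lam := (closed_class p sigma).

(* The class of [f] read as an element of the free product, given that one of the
   two factors below is trivial; [theta] multiplies up dyadic subdivisions. *)
Definition step f s :=
  push false (lam (rho false \o f)) (push true (lam (rho true \o f)) s).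

Fixpoint theta m f s :=
  if m is m'.+1 then theta m' (half 1 f) (theta m' (half 0 f) s) else step f s.

Lemma reduced_theta m f s : reduced s -> reduced (theta m f s).
Proof.
elim: m f s => [|m IH] f s rs /=; first by do 2 apply: reduced_push.
by apply/IH/IH.
Qed.

Lemma closed_class_half f : continuous f -> lam f = (lam (half 0 f) * lam (half 1 f))%g.
Proof.
move=> cf; have cf0 := continuous_half (i := 0) cf; have cf1 := continuous_half (i := 1) cf.
have f01 : half 0 f 1 = half 1 f 0 by rewrite /half; congr (f _); lra.
rewrite -closed_class_pcat//; apply: closed_class_homotopic => //.
  exact: continuous_pcat.
apply: path_homotopic_eq => // t t01; rewrite /pcat /half.
by case: ifP => _; congr (f _); field.
Qed.

(** All letters from the factor [c] are trivial, so the letters from the other factor are adjacent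
    and multiply up to the class of the whole path. The depth [m] thus drops out of the value. *)
Lemma theta_V c m f s : continuous f ->
  (forall t, 0 <= t <= 1 -> V c (rho c (f t))) -> reduced s ->
  theta m f s = push (~~ c) (lam (rho (~~ c) \o f)) s.
Proof.
elim: m f s => [|m IH] f s cf fV rs /=.
  have Vc : lam (rho c \o f) = 1%g.
    by apply: (@closed_class_V c) => //; exact: continuous_comp_fun.
  by rewrite /step; case: (c) Vc => -> /=; rewrite push1.
have fV' (i : R) : 0 <= i <= 1 ->
    forall t, 0 <= t <= 1 -> V c (rho c (half i f t)).
  by move=> i01 t t01; apply: fV; lra.
have cf' i : continuous (half i f) by exact: continuous_half.
rewrite (IH (half 0 f))//; last by apply: fV'; lra.
rewrite (IH (half 1 f))//; [|by apply: fV'; lra|exact: reduced_push].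
rewrite -pushM//; congr (push _ _ _); apply/esym.
exact: (closed_class_half (continuous_comp_fun cf (rho_continuous (c := ~~ c)))).
Qed.

(* On a small square one of the two letters is invisible: either [rho true \o H]
   stays in [V true], or it avoids [p] and then [rho false \o H] is constant. *)
Definition small_square H :=
  (forall z, unit_square z -> V true (rho true (H z))) \/
  (forall z, unit_square z -> V false (rho false (H z))).

(** The boundary path is pushed across the upper left, lower left, upper right and lower right
    quarters in this order, each time by induction. At depth 0 letters of only one factor survive,
    and their product is the class of a path that can be deformed across the square. *)
Lemma theta_square m H s : continuous H -> subdivided small_square m H ->
  reduced s ->
  theta m (fun t => H (t, 1)) (theta m (fun t => H (0, t)) s) =
  theta m (fun t => H (1, t)) (theta m (fun t => H (t, 0)) s).
Proof.
elim: m H s => [|m IH] H s cH; last first.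
  move=> /= [h00 h01 h10 h11] rs.
  have E (a b a' b' : R -> R) : (forall t, a t = a' t) -> (forall t, b t = b' t) ->
      (fun t => H (a t, b t)) = (fun t => H (a' t, b' t)).
    by move=> aa' bb'; apply/funext => t; rewrite aa' bb'.
  pose q i j := quarter i j H.
  have cq i j : continuous (q i j) by exact: continuous_quarter.
  have -> : half 1 (fun t => H (t, 1)) = (fun t => q 1 1 (t, 1)).
    by apply: E => t /=; field.
  have -> : half 0 (fun t => H (t, 1)) = (fun t => q 0 1 (t, 1)).
    by apply: E => t /=; field.
  have -> : half 1 (fun t => H (0, t)) = (fun t => q 0 1 (0, t)).
    by apply: E => t /=; field.
  have -> : half 0 (fun t => H (0, t)) = (fun t => q 0 0 (0, t)).
    by apply: E => t /=; field.
  have -> : half 1 (fun t => H (1, t)) = (fun t => q 1 1 (1, t)).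
    by apply: E => t /=; field.
  have -> : half 0 (fun t => H (1, t)) = (fun t => q 1 0 (1, t)).
    by apply: E => t /=; field.
  have -> : half 1 (fun t => H (t, 0)) = (fun t => q 1 0 (t, 0)).
    by apply: E => t /=; field.
  have -> : half 0 (fun t => H (t, 0)) = (fun t => q 0 0 (t, 0)).
    by apply: E => t /=; field.
  rewrite (IH (q 0 1))//; last exact: reduced_theta.
  have -> : (fun t => q 0 1 (t, 0)) = (fun t => q 0 0 (t, 1)).
    by apply: E => t /=; field.
  rewrite (IH (q 0 0))//.
  have -> : (fun t => q 0 1 (1, t)) = (fun t => q 1 1 (0, t)).
    by apply: E => t /=; field.
  rewrite (IH (q 1 1))//; last by do 2 apply: reduced_theta.
  have -> : (fun t => q 1 1 (t, 0)) = (fun t => q 1 0 (t, 1)).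
    by apply: E => t /=; field.
  have -> : (fun t => q 0 0 (1, t)) = (fun t => q 1 0 (0, t)).
    by apply: E => t /=; field.
  by rewrite (IH (q 1 0))//; exact: reduced_theta.
move=> sH rs.
have [c cV] : exists c, forall z, unit_square z -> V c (rho c (H z)).
  by case: sH => HV; [exists true|exists false].
have c1 : continuous (fun t : R => H (t, 1)) by cts.
have c2 : continuous (fun t : R => H (0, t)) by cts.
have c3 : continuous (fun t : R => H (1, t)) by cts.
have c4 : continuous (fun t : R => H (t, 0)) by cts.
rewrite !(@theta_V c 0); try (by []); try (by apply: reduced_push);
  try by move=> t t01; apply: cV; rewrite /unit_square /=; lra.
have cr (f : R -> X) : continuous f -> continuous (rho (~~ c) \o f).
  by move=> cf; exact: continuous_comp_fun.
rewrite -!pushM//; congr (push _ _ _).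
rewrite -!closed_class_pcat//; try exact: cr.
apply: closed_class_homotopic => //; try by apply: continuous_pcat => //; exact: cr.
pose K z := rho (~~ c) (H z).
have cK : continuous K by exact: continuous_comp_fun.
(* The two halves of the boundary, as plane curves from (0, 0) to (1, 1). *)
apply: (@path_homotopic_trans _ _
  (fun t => K (Num.max 0 (2 * t - 1), Num.min (2 * t) 1))).
  apply: path_homotopic_eq; first by apply: continuous_pcat => //; exact: cr.
  move=> t t01; rewrite /pcat /K /=; split_cases; congr (rho _ (H (_, _))); lra.
apply: (@path_homotopic_trans _ _
  (fun t => K (Num.min (2 * t) 1, Num.max 0 (2 * t - 1)))).
  by apply: path_homotopic_straight => //; try cts; split_cases; lra.
apply: path_homotopic_eq; first by cts.
move=> t t01; rewrite /pcat /K /=; split_cases; congr (rho _ (H (_, _))); lra.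
Qed.

Lemma theta_eq m f g s : continuous f -> continuous g ->
  (forall t, 0 <= t <= 1 -> f t = g t) -> theta m f s = theta m g s.
Proof.
elim: m f g s => [|m IH] f g s cf cg fg /=.
  rewrite /step; congr (push _ _ (push _ _ _));
  (apply: closed_class_homotopic => //; try exact: continuous_comp_fun);
  by apply: path_homotopic_eq; [exact: continuous_comp_fun|move=> t t01 /=; rewrite fg].
have h i : continuous (half i f) by exact: continuous_half.
have h' i : continuous (half i g) by exact: continuous_half.
rewrite (IH (half 0 f) (half 0 g))//; last by move=> t t01; apply: fg; lra.
by apply: IH => // t t01; apply: fg; lra.
Qed.

(** [pcat] and [theta] both split at the midpoint, so a concatenation costs exactly one level of
    depth. *)
Lemma theta_pcat m f g s : continuous f -> continuous g -> f 1 = g 0 ->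
  theta m.+1 (pcat f g) s = theta m g (theta m f s).
Proof.
move=> cf cg fg /=; have cfg : continuous (pcat f g) by exact: continuous_pcat.
have h i : continuous (half i (pcat f g)) by exact: continuous_half.
rewrite (@theta_eq m (half 0 (pcat f g)) f)//; last first.
  by move=> t t01; rewrite /half /pcat ifT; [congr (f _); field|lra].
apply: theta_eq => // t t01; rewrite /half /pcat; case: ifPn => t2.
  have -> : t = 0 by lra.
  by rewrite -fg; congr (f _); field.
by congr (g _); field.
Qed.

Lemma theta_cst m s : reduced s -> theta m (cst p) s = s.
Proof.
move=> rs; rewrite (@theta_V true)//; [|exact: cst_continuous|].
  rewrite (@closed_class_V false) ?push1// => [|t _ /=]; last by rewrite rho_p.
  by apply: continuous_comp_fun; [exact: cst_continuous|exact: rho_continuous].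
by move=> t _ /=; rewrite rho_p.
Qed.

Lemma theta_loop c m f s : sigma p = cst p -> is_path p p f ->
  (forall t, rho c (f t) = f t) -> (forall t, rho (~~ c) (f t) = p) ->
  reduced s -> theta m f s = push c (loop_class p f) s.
Proof.
move=> sp fp fc fc' rs; have [cf _ _] := fp.
rewrite (@theta_V (~~ c))//; last by move=> t _; rewrite fc'.
rewrite negbK; congr (push _ _ _).
have -> : rho c \o f = f by apply/funext => t /=; rewrite fc.
exact: closed_class_loop.
Qed.

(** Each of the [2 ^ k] pieces at depth [k] contributes at most one letter, however much further it
    is subdivided: by [theta_V] the extra depth [m] has no effect on it. *)
Lemma size_theta k m f s : continuous f ->
  subdivided small_square k (fun z => f z.2) -> reduced s ->
  (size (theta (k + m) f s) <= size s + 2 ^ k)%N.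
Proof.
elim: k f s => [|k IH] f s cf /=; last first.
  (* The first coordinate is idle, so the two quarters with [i = 0] already cover both halves of
     [f]. *)
  move=> [h0 h1 _ _] rs; rewrite expnS mul2n -addnn addnA.
  apply: (leq_trans (IH (half 1 f) _ _ h1 _)); first exact: continuous_half.
    exact: reduced_theta.
  rewrite leq_add2r; apply: (IH (half 0 f) _ _ h0) => //.
  exact: continuous_half.
move=> sf rs.
have [c cV] : exists c, forall t, 0 <= t <= 1 -> V c (rho c (f t)).
  case: sf => HV; [exists true|exists false] => t t01;
  by apply: (HV (0, t)); split=> //=; lra.
by rewrite add0n (theta_V _ cf cV)// expn0 addn1; exact: size_push.
Qed.

Lemma small_square_quarter H (i j : R) : 0 <= i <= 1 -> 0 <= j <= 1 ->
  small_square H -> small_square (quarter i j H).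
Proof.
move=> i01 j01 [HV|HV]; [left|right] => z [z1 z2]; apply: HV;
by rewrite /unit_square /=; lra.
Qed.

Lemma subdivided_leq k m H : (k <= m)%N ->
  subdivided small_square k H -> subdivided small_square m H.
Proof.
move=> /subnK <-; elim: (m - k)%N => // n IH /IH; rewrite addSn.
move: (n + k)%N => l; elim: l H {IH} => [|l IHl] H /=.
  by move=> sH; split; apply: small_square_quarter => //; lra.
by case=> *; split; exact: IHl.
Qed.

Variable e : R.
Hypothesis e0 : 0 < e.
Hypothesis V_ball : forall x, mdist p (rho true x) < e -> V true (rho true x).

(** Suppose [rho true] leaves [V true] at some point [w] of the square. If it took the value [p]
    elsewhere on the square, its value at [w] would lie within [e] of [p], hence in [V true]. So it
    avoids [p], and [rho false] is constantly [p]. The mesh is therefore governed by [rho true]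
    alone. *)
Lemma small_squareP H :
  (forall z w, unit_square z -> unit_square w ->
    mdist ((rho true \o H) z) ((rho true \o H) w) < e) -> small_square H.
Proof.
move=> He; have [?|/existsNP[w /not_implyP[w1 HwV]]] :=
  pselect (forall z, unit_square z -> V true (rho true (H z))); first by left.
right=> z z1; rewrite rho_wedge ?Vp// => zp; apply/HwV/V_ball.
by rewrite -zp; exact: He.
Qed.

(** Two opposite sides of the homotopy square are constant at [p] and act trivially, so
    [theta_square] compares the remaining two, which are [f] and [g]. *)
Lemma theta_homotopic f g : is_path p p f -> is_path p p g -> path_homotopic f g ->
  exists k, forall m s, (k <= m)%N -> reduced s -> theta m f s = theta m g s.
Proof.
move=> [cf f0 f1] [cg g0 g1] [H [cH Hfg Hs]].
have cH' : continuous (rho true \o H) by exact: continuous_comp_fun.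
have [k kH] := subdivided_small cH' e0.
have {}kH := subdivided_comp small_squareP kH.
exists k => m s km rs.
have := theta_square cH (subdivided_leq km kH) rs.
have cc : continuous (cst p : R -> X) by exact: cst_continuous.
have E (a : R -> X) : continuous a -> (forall t, 0 <= t <= 1 -> a t = p) ->
    forall s', reduced s' -> theta m a s' = s'.
  by move=> ca ap s' rs'; rewrite (theta_eq _ _ ca cc)// theta_cst.
rewrite (E (fun t => H (t, 1))); [|by cts|by move=> t /Hs[_ ->]|exact: reduced_theta].
rewrite (E (fun t => H (t, 0))); [|by cts|by move=> t /Hs[-> _]|by []].
rewrite (@theta_eq _ (fun t => H (0, t)) f)//; [|by cts|by move=> t /Hfg[]].
by rewrite (@theta_eq _ (fun t => H (1, t)) g)//; [cts|by move=> t /Hfg[]].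
Qed.

(** * Powers of a commutator *)

(** The balanced bracketing exposes all four letters after two dyadic levels. Each factor of [word]
    costs one level more, whence the depth [n + 2] required below. *)
Definition pcomm (a b : R -> X) : R -> X := pcat (pcat a b) (pcat (revp a) (revp b)).

Definition word (a b : R -> X) n : R -> X := iter n (pcat (pcomm a b)) (cst p).

Lemma is_path_pcomm a b : is_path p p a -> is_path p p b -> is_path p p (pcomm a b).
Proof.
move=> ap bp; apply: (is_path_pcat (is_path_pcat ap bp)).
exact: is_path_pcat (is_path_revp ap) (is_path_revp bp).
Qed.

Lemma is_path_word a b n : is_path p p a -> is_path p p b -> is_path p p (word a b n).
Proof.
move=> ap bp; elim: n => [|n IH]; first exact: is_path_cst.
exact: is_path_pcat (is_path_pcomm ap bp) IH.
Qed.

(** The letters of a commutator alternate between the factors and are nontrivial. As [s] is empty or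
    ends in the factor [false], nothing cancels; the new word again ends in the factor [false],
    which keeps the induction going. *)
Lemma size_theta_word a b n m s : sigma p = cst p ->
  is_path p p a -> is_path p p b ->
  (forall t, rho true (a t) = a t) -> (forall t, rho false (a t) = p) ->
  (forall t, rho true (b t) = p) -> (forall t, rho false (b t) = b t) ->
  loop_class p a <> 1%g -> loop_class p b <> 1%g ->
  (n + 2 <= m)%N -> reduced s -> (if s is x :: _ then ~~ x.1 else true) ->
  size (theta m (word a b n) s) = (4 * n + size s)%N.
Proof.
move=> sp ap bp at_ af bt bf /eqP a1 /eqP b1.
elim: n m s => [|n IH] m s nm rs s1; first by rewrite theta_cst.
case: m nm => [|[|[|m]]] nm; rewrite ?addnS//= in nm.
have aVp := is_path_revp ap; have bVp := is_path_revp bp.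
have abp := is_path_pcat ap bp; have abVp := is_path_pcat aVp bVp.
have cp := is_path_pcomm ap bp; have wp := is_path_word n ap bp.
move: (ap) (bp) (aVp) (bVp) (abp) (abVp) (cp) (wp).
move=> [? a0 a1'] [? b0 b1'] [? aV0 aV1] [? bV0 bV1] [? ab0 ab1] [? abV0 abV1].
move=> [? c0 c1] [? w0 w1].
rewrite /word iterS theta_pcat ?c1//; rewrite -/(word a b n).
rewrite theta_pcat ?ab1// !theta_pcat ?a1' ?aV1//.
rewrite !(@theta_loop true m (revp a), @theta_loop false m (revp b),
  @theta_loop true m a, @theta_loop false m b)//; try (by move=> t; rewrite /revp);
  try by do ?apply: reduced_push.
have E : push false (loop_class p (revp b)) (push true (loop_class p (revp a))
    (push false (loop_class p b) (push true (loop_class p a) s))) =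
    [:: (false, loop_class p (revp b)), (true, loop_class p (revp a)),
      (false, loop_class p b), (true, loop_class p a) & s].
  rewrite !loop_classV// /push !invg_eq1 (negPf a1) (negPf b1).
  by case: s rs s1 => [//|[[] h] s].
rewrite IH ?E//=; first by rewrite mulnS -addnA addnCA.
- by rewrite -!addnS in nm *.
- by rewrite -E; do 4 apply: reduced_push.
Qed.

End word_action.

(** * Spaces similar to the Hawaiian earring *)

Lemma continuous_set_type_lift (Z X : topologicalType) (A : set X)
    (g : Z -> set_type A) :
  continuous (fun z => val (g z)) -> continuous g.
Proof. by move=> cg; apply/continuous_comp_initial. Qed.

Lemma continuous_set_type_val (X : topologicalType) (A : set X) :
  continuous (val : set_type A -> X).
Proof. exact: initial_continuous. Qed.

(** The right-hand side does not mention [f]: once all loops at [q] are null, any two loops at [x]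
    are homotopic. *)
Lemma path_homotopic_null_base_change (R : realType) (T : topologicalType)
    (q x : T) (s f : R -> T) :
  is_path q x s -> is_path x x f ->
  (forall g : R -> T, is_path q q g -> path_homotopic g (cst q)) ->
  path_homotopic f (pconj (revp s) (cst q) (revp s)).
Proof.
move=> sp fp null; have sfp := is_path_pconj sp fp sp.
apply: path_homotopic_trans (path_homotopic_sym (pconjK sp fp)) _.
by apply: (path_homotopic_pconj (is_path_revp sp) sfp (is_path_revp sp)); exact: null.
Qed.

Section hawaiian.
Context {R : realType} {X : metricType R} (p : X) (Y : nat -> set X).
Hypothesis Y_cover : \bigcup_n Y n = [set: X].
Hypothesis Y_wedge : forall n m, n != m -> Y n `&` Y m = [set p].
Hypothesis Y_closed : forall n, closed (Y n).
Hypothesis Y_diam : diam (Y n) @[n --> \oo] --> 0%E.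

Lemma Y_base n : Y n p.
Proof.
suff [] : (Y n `&` Y n.+1) p by [].
by rewrite Y_wedge// neq_ltn ltnSn.
Qed.

Lemma Y_ex x : exists n, Y n x.
Proof.
have : (\bigcup_n Y n) x by rewrite Y_cover.
by case=> n _ Yx; exists n.
Qed.

Lemma Y_uniq n m x : Y n x -> Y m x -> x <> p -> n = m.
Proof.
move=> Yn Ym xp; apply/eqP/negP => /negP nm.
by apply: xp; have : (Y n `&` Y m) x; [split|rewrite Y_wedge].
Qed.

Lemma Y_small (e : R) : 0 < e ->
  exists N, forall n x, (N <= n)%N -> Y n x -> mdist p x < e.
Proof.
move=> e0; have : nbhs 0%E [set u : \bar R | (u < e%:E)%E].
  by apply: open_ereal_lt'; rewrite lte_fin.
move=> /Y_diam[N _ NP]; exists N => n x Nn Ynx.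
rewrite -lte_fin; apply: le_lt_trans (NP n Nn).
by apply: ereal_sup_ubound; exists (p, x) => //; split=> //; exact: Y_base.
Qed.

(** All but finitely many pieces lie too close to [p] to come near [x]; each of the finitely many
    others, apart from [Y n], is closed and misses [x]. *)
Lemma nbhs_Y n x : x <> p -> Y n x -> nbhs x (Y n).
Proof.
(* With half the distance, no point is within [e] of both [p] and [x]. *)
move=> xp Yx; pose e := mdist p x / 2.
have e0 : 0 < e by rewrite divr_gt0// mdist_gt0; apply/eqP => /esym.
have [N NP] := Y_small e0.
have hN : \forall y \near x, forall m : 'I_N, m != n :> nat -> ~ Y m y.
  apply: filter_forall => m; have [->|mn] := eqVneq (m : nat) n.
    by near=> y.
  have : nbhs x (~` Y m).
    apply: open_nbhs_nbhs; split; first exact/closed_openC/Y_closed.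
    by move=> Ymx; move/eqP: mn; apply; exact: Y_uniq Ymx Yx xp.
  by apply: filterS.
have he : nbhs x (ball x e) by exact: nbhsx_ballx.
apply: filterS (filterI hN he) => y [yN]; rewrite ballEmdist /= => xy.
have [m Ymy] := Y_ex y; have [Nm|mN] := leqP N m.
  have py := NP m y Nm Ymy.
  by have := metric_triangle p y x; rewrite (metric_sym y x) /e in e0 py xy *; lra.
have [<-//|mn] := eqVneq m n.
by case: (yN (Ordinal mN) mn).
Unshelve. all: by end_near. Qed.

Definition collapse (S : nat -> bool) (x : X) : X :=
  if `[< exists2 n, S n & Y n x >] then x else p.

Lemma collapse_id (S : nat -> bool) n x : S n -> Y n x -> collapse S x = x.
Proof. by move=> Sn Yx; rewrite /collapse ifT//; apply/asboolP; exists n. Qed.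

Lemma collapse_base (S : nat -> bool) x : (exists2 n, ~~ S n & Y n x) -> collapse S x = p.
Proof.
move=> [n Sn Yx]; rewrite /collapse; case: asboolP => // -[m Sm Ymx].
apply: contrapT => xp; move: Sn; rewrite (Y_uniq Yx Ymx)//.
by rewrite Sm.
Qed.

Lemma collapse_p (S : nat -> bool) : collapse S p = p.
Proof. by rewrite /collapse; case: ifP. Qed.

(** Distances to [p] do not increase, which gives continuity at [p]. Near any other point the map is
    the identity or constant, by [nbhs_Y]. *)
Lemma continuous_collapse (S : nat -> bool) : continuous (collapse S).
Proof.
move=> x; have [->|xp] := pselect (x = p).
  rewrite /continuous_at collapse_p => U /nbhs_ballP[e /= e0 eU].
  apply/nbhs_ballP; exists e => //= y py; apply: eU.
  by rewrite /collapse; case: ifP => // _; exact: ballxx.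
have [n Yx] := Y_ex x.
have nYx := nbhs_Y xp Yx.
have [Sn|Sn] := boolP (S n).
  rewrite /continuous_at (collapse_id Sn Yx) => U Ux.
  rewrite nbhs_simpl /=; apply: filterS (filterI nYx Ux) => y [Yy Uy] /=.
  by rewrite (collapse_id Sn Yy).
rewrite /continuous_at collapse_base; last by exists n.
move=> U Up; rewrite nbhs_simpl /=; apply: filterS nYx => y Yy /=.
by rewrite collapse_base; [exact: nbhs_singleton|exists n].
Qed.

Lemma collapse_collapse (S S' : nat -> bool) x :
  (forall n, S n -> S' n) -> collapse S (collapse S' x) = collapse S x.
Proof.
move=> SS'; have [n Yx] := Y_ex x.
have [S'n|S'n] := boolP (S' n); first by rewrite (collapse_id S'n Yx).
rewrite (@collapse_base S'); last by exists n.
rewrite collapse_p collapse_base//; exists n => //.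
by apply: contra S'n; exact: SS'.
Qed.

(** The loop has to be essential in [X] and not merely in [Y n]: collapsing the other pieces
    retracts [X] onto [Y n], so a contraction in [X] yields one in [Y n]. Path connectedness brings
    the base point to [p]. *)
Lemma essential_loop n : path_connected_space R (set_type (Y n)) ->
  ~ simply_connected R (set_type (Y n)) ->
  exists a : R -> X,
    [/\ is_path p p a, forall t, Y n (a t) & loop_class p a <> 1%g].
Proof.
move=> pc nsc; apply: contrapT => noloop; apply: nsc; split=> // x a b.
pose q : set_type (Y n) := exist _ p (mem_set (Y_base n)).
pose S m := m == n.
have YS y : Y n (collapse S y).
  rewrite /collapse; case: asboolP => [[m /eqP -> //]|_]; exact: Y_base.
pose r (y : X) : set_type (Y n) := exist _ (collapse S y) (mem_set (YS y)).
have cr : continuous r.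
  by apply: continuous_set_type_lift; exact: continuous_collapse.
have rK (y : set_type (Y n)) : r (val y) = y.
  by apply: val_inj => /=; rewrite (@collapse_id S n)// ?/S//; exact: set_valP.
have null (g : R -> set_type (Y n)) : is_path q q g -> path_homotopic g (cst q).
  move=> [cg g0 g1].
  have vp : is_path p p (val \o g).
    split; [|by rewrite /= g0|by rewrite /= g1].
    by apply: continuous_comp_fun cg _; exact: continuous_set_type_val.
  have : path_homotopic (val \o g) (cst p).
    apply/(loop_class_eqP vp (is_path_cst p)); apply: contrapT => ng.
    by apply: noloop; exists (val \o g); split=> // t; exact: set_valP.
  move=> /(path_homotopic_comp cr).
  have -> : r \o (val \o g) = g by apply/funext => t /=; rewrite rK.
  suff -> : r \o cst p = cst q :> (R -> _) by [].
  by apply/funext => t; apply: val_inj => /=; rewrite collapse_p.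
have [G] := pc q x.
pose s : R -> set_type (Y n) := fun t => G (clamp t).
have sp : is_path q x s.
  split; [|exact: path_zero|exact: path_one].
  by apply: continuous_comp_fun; [exact: continuous_clamp|exact: cts_fun].
have [f fp ->] := loop_class_surj a; have [g gp ->] := loop_class_surj b.
apply/loop_class_eqP => //.
apply: path_homotopic_trans (path_homotopic_null_base_change sp fp null) _.
exact: path_homotopic_sym (path_homotopic_null_base_change sp gp null).
Qed.

(** A neighbourhood of [p] relative to [Y n], as a subset of [X]. Its loops at [p] are required to
    be null in [X], so a contraction may leave [V]. *)
Definition good_nbhd n (V : set X) :=
  [/\ V `<=` Y n,
      exists2 e : R, 0 < e & forall x, Y n x -> mdist p x < e -> V x,
      forall x, V x -> exists2 s, is_path p x s & forall t : R, V (s t) &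
      forall g : R -> X, is_path p p g -> (forall t, V (g t)) ->
        loop_class p g = 1%g].

Lemma ex_good_nbhd n :
  (forall q : set_type (Y n), val q = p -> locally_simply_connected_at R q) ->
  exists V, good_nbhd n V.
Proof.
pose q : set_type (Y n) := exist _ p (mem_set (Y_base n)).
move=> /(_ q erefl setT filterT)[W [nW _ [pcW scW]]].
(* [W] lives in a subspace of a subspace; its image under [w] is the neighbourhood sought, and paths
   in the image lift back because both subspace topologies are initial. *)
pose w : set_type W -> X := fun v => val (val v).
have cw : continuous w.
  by apply: continuous_comp_fun; exact: continuous_set_type_val.
have w_inj : injective w by move=> v v' /val_inj/val_inj.
pose qW : set_type W := exist _ q (mem_set (nbhs_singleton nW)).
have wq : w qW = p by [].
have lift (g : R -> X) : continuous g -> (forall t, range w (g t)) ->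
    exists2 g' : R -> set_type W, continuous g' & w \o g' = g.
  move=> cg Wg; have [g' g'P] := choice (fun t => let: ex_intro2 v _ wv := Wg t in
    ex_intro (fun v => w v = g t) v wv).
  exists g'; last exact/funext.
  apply: continuous_set_type_lift; apply: continuous_set_type_lift.
  have -> : (fun z => val (val (g' z))) = g by apply/funext.
  exact: cg.
exists (range w); split.
- by move=> _ [v _ <-]; exact: set_valP.
- have [_ [[A oA <-] Aq] AW] := nW.
  have /nbhs_ballP[e /= e0 eA] : nbhs p A by exact: open_nbhs_nbhs.
  exists e => // x Yx px.
  have Wx : W (exist _ x (mem_set Yx)).
    by apply: AW => /=; apply: eA; rewrite ballEmdist.
  by exists (exist _ (exist _ x (mem_set Yx)) (mem_set Wx)).
- move=> _ [v _ <-]; have [G] := pcW qW v.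
  exists (fun t => w (G (clamp t))); last by move=> t; exists (G (clamp t)).
  split; last 2 first.
  + by rewrite -unit_itv0 path_zero.
  + by rewrite -unit_itv1 path_one.
  apply: continuous_comp_fun cw.
  by apply: continuous_comp_fun; [exact: continuous_clamp|exact: cts_fun].
- move=> g gp Wg; have [cg g0 g1] := gp; have [g' cg' g'E] := lift g cg Wg.
  have gp' : is_path qW qW g'.
    split=> //; apply: w_inj; rewrite wq.
      by rewrite -g0 -g'E.
    by rewrite -g1 -g'E.
  have : path_homotopic g' (cst qW).
    by apply/(loop_class_eqP gp' (is_path_cst qW)); exact: scW.
  move=> /(path_homotopic_comp cw); rewrite g'E => h.
  exact/(loop_class_eqP gp (is_path_cst p)).
Qed.

(** A point other than [p] lies in a single piece, so at most one neighbourhood constrains its path.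
    The point [p] lies in all of them, and the constant path suits them all. *)
Lemma ex_connecting_paths (V : nat -> set X) :
  (forall n, path_connected_space R (set_type (Y n))) ->
  (forall n, good_nbhd n (V n)) ->
  exists sigma : X -> R -> X,
    [/\ forall x, is_path p x (sigma x), sigma p = cst p &
        forall n x, V n x -> forall t, V n (sigma x t)].
Proof.
move=> pc gV.
suff /choice[sigma sP] : forall x, exists s : R -> X,
    [/\ is_path p x s, x = p -> s = cst p & forall n, V n x -> forall t, V n (s t)].
  exists sigma; split=> [x||n x Vx].
  - by have [] := sP x.
  - by have [_ h _] := sP p; exact: h.
  - by have [_ _ h] := sP x; exact: h.
move=> x; have [->|xp] := pselect (x = p).
  by exists (cst p); split=> //; exact: is_path_cst.
have [n Yx] := Y_ex x.
have [Vx|nVx] := pselect (V n x).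
  have [VY _ /(_ x Vx)[s sp sV] _] := gV n; exists s; split=> // m Vmx.
  have [VmY _ _ _] := gV m.
  by rewrite -(Y_uniq Yx (VmY _ Vmx) xp).
pose q : set_type (Y n) := exist _ p (mem_set (Y_base n)).
have [G] := pc n q (exist _ x (mem_set Yx)).
exists (fun t => val (G (clamp t))); split=> [|//|m Vmx]; last first.
  have [VmY _ _ _] := gV m; case: nVx.
  by rewrite (Y_uniq Yx (VmY _ Vmx) xp).
split; last 2 first.
- by rewrite -unit_itv0 path_zero.
- by rewrite -unit_itv1 path_one.
apply: (continuous_comp_fun _ (@continuous_set_type_val _ _)).
by apply: continuous_comp_fun; [exact: continuous_clamp|exact: cts_fun].
Qed.

(** Path, departure and return all stay in [V]. Clamping is needed because [g] is confined to [V]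
    only on [0, 1]. *)
Lemma closed_class_good_nbhd n V (sigma : X -> R -> X) (g : R -> X) :
  good_nbhd n V -> (forall x, is_path p x (sigma x)) ->
  (forall x, V x -> forall t, V (sigma x t)) -> continuous g ->
  (forall t, 0 <= t <= 1 -> V (g t)) -> closed_class p sigma g = 1%g.
Proof.
move=> [_ _ _ null] sP sV cg gV.
pose h t := g (clampr t).
have ch : continuous h by exact: continuous_comp_fun (@continuous_clampr R) cg.
have hV t : V (h t) by apply: gV; exact: clampr01.
rewrite (@closed_class_homotopic _ _ _ _ sP g h)//; last first.
  by apply: path_homotopic_eq => // t t01; rewrite /h clampr_id.
apply: null; first exact: is_path_pconj (sP _) (is_path_ends ch) (sP _).
move=> t; rewrite /pconj /pcat; case: ifP => _; first exact: sV (hV 0) _.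
by case: ifP => _; [exact: hV|exact: sV (hV 1) _].
Qed.

End hawaiian.

(** * A syllable bound uniform in the second piece *)

Section hawaiian_words.
Context {R : realType} {X : metricType R} (p : X) (Y : nat -> set X).
Hypothesis Y_cover : \bigcup_n Y n = [set: X].
Hypothesis Y_wedge : forall n m, n != m -> Y n `&` Y m = [set p].
Hypothesis Y_closed : forall n, closed (Y n).
Hypothesis Y_diam : diam (Y n) @[n --> \oo] --> 0%E.
Variables (V : nat -> set X) (sigma : X -> R -> X) (b : nat -> R -> X).
Hypothesis V_good : forall n, good_nbhd p Y n (V n).
Hypothesis sigmaP : forall x, is_path p x (sigma x).
Hypothesis sigma_p : sigma p = cst p.
Hypothesis sigma_V : forall n x, V n x -> forall t, V n (sigma x t).
Hypothesis b_path : forall n, is_path p p (b n).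
Hypothesis b_Y : forall n t, Y n (b n t).
Hypothesis b_essential : forall n, loop_class p (b n) <> 1%g.

Definition pair_of (k n : nat) : bool := (n == 0%N) || (n == k).

(** The depth [m0] comes from the projection of [f] to piece 0. Collapsing first to the pieces 0 and
    k does not change this projection, so the bound [2 ^ m0] holds for every [k]. *)
Lemma word_length_bounded (f : R -> X) : is_path p p f ->
  exists N, forall k n, k != 0%N ->
    path_homotopic (collapse p Y (pair_of k) \o f) (word p (b 0%N) (b k) n) ->
    (4 * n <= N)%N.
Proof.
move=> fp; have [cf _ _] := fp.
have cC S : continuous (collapse p Y S) by exact: continuous_collapse.
have [V0Y [e e0 V0e] _ _] := V_good 0%N.
have cF : continuous (collapse p Y (pred1 0%N) \o (fun z : R * R => f z.2)).
  by apply: continuous_comp_fun (cC _); cts.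
have [m0 fm0] := subdivided_small cF e0.
exists (2 ^ m0)%N => k n k0 fw.
pose rho (c : bool) := collapse p Y (pred1 (if c then 0%N else k)).
pose V' (c : bool) := V (if c then 0%N else k).
have crho c : continuous (rho c) by exact: cC.
have rho_p c : rho c p = p by exact: collapse_p.
have Vp c : V' c p.
  rewrite /V'; have [_ [d d0 dV] _ _] := V_good (if c then 0%N else k).
  by apply: dV; [exact: Y_base|rewrite mdistxx].
have rho_id c n' x : Y n' x -> n' = (if c then 0%N else k) -> rho c x = x.
  by move=> Yx nE; apply: collapse_id Yx; rewrite nE /=.
have rho_0 c n' x : Y n' x -> n' != (if c then 0%N else k) -> rho c x = p.
  by move=> Yx nE; apply: (collapse_base Y_wedge); exists n'.
have rho_wedge x : rho true x <> p -> rho false x = p.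
  have [n' Yx] := Y_ex Y_cover x; have [n0 _|n0] := eqVneq n' 0%N.
    by apply: (rho_0 false) Yx _; rewrite n0 eq_sym.
  by rewrite (rho_0 true _ _ Yx).
have clV c (g : R -> X) : continuous g ->
    (forall t, 0 <= t <= 1 -> V' c (g t)) -> closed_class p sigma g = 1%g.
  by move=> cg gV; exact: closed_class_good_nbhd (V_good _) sigmaP (@sigma_V _) cg gV.
have V_ball x : mdist p (rho true x) < e -> V' true (rho true x).
  apply: V0e; have [n' Yx] := Y_ex Y_cover x; have [n0|n0] := eqVneq n' 0%N.
    by rewrite (rho_id true _ _ Yx)// -n0.
  by rewrite (rho_0 true _ _ Yx)//; exact: Y_base.
pose f' := collapse p Y (pair_of k) \o f.
have fp' : is_path p p f' by apply: (is_path_comp (cC _) _ fp); exact: collapse_p.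
have [cf' _ _] := fp'.
have wp := is_path_word n (b_path 0%N) (b_path k).
have subf : subdivided (small_square rho V') m0 (fun z => f' z.2).
  apply: (subdivided_comp (phi := rho true) (@small_squareP _ _ _ _ _
    rho_wedge Vp e V_ball)).
  suff -> : rho true \o (fun z : R * R => f' z.2) =
      collapse p Y (pred1 0%N) \o (fun z : R * R => f z.2) by exact: fm0.
  apply/funext => z /=; apply: (collapse_collapse Y_cover Y_wedge) => n' /=.
  by rewrite /pair_of => ->.
have [m1 thE] := theta_homotopic sigmaP crho rho_wedge rho_p Vp clV e0 V_ball
  fp' wp fw.
(* The total depth [m0 + (m1 + (n + 2))] suffices at once for the bound, for homotopy invariance and
   for reading off the word. *)
have := size_theta sigmaP crho clV (m1 + (n + 2)) cf' subf (s := [::]) isT.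
rewrite thE//; last by rewrite addnCA leq_addr.
rewrite (size_theta_word sigmaP crho rho_p Vp clV)//= ?addn0 ?add0n//.
- by move=> t; exact: rho_id (b_Y 0%N t) _.
- by move=> t; apply: rho_0 (b_Y 0%N t) _; rewrite eq_sym.
- by move=> t; exact: rho_0 (b_Y k t) _.
- by move=> t; exact: rho_id (b_Y k t) _.
- by rewrite addnA leq_addl.
Qed.

End hawaiian_words.

(** * The Cauchy sequence and its limit *)

Lemma completely_metrizable_eq_lim (R : realType) (T : topologicalType)
    (phi : T -> T) (u : nat -> T) (l c : T) (N : nat) :
  completely_metrizable R T -> continuous phi -> u @ \oo --> l ->
  (forall j, (N <= j)%N -> phi (u j) = c) -> phi l = c.
Proof.
move=> [d [[d0 deq dsym dtri] dn _]] cphi ul uc; apply: contrapT => lc.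
have dlc : 0 < d (phi l) c.
  by rewrite lt_neqAle d0 andbT eq_sym; apply/eqP => /deq.
have : nbhs (phi l) [set x | d (phi l) x < d (phi l) c] by apply/dn; exists (d (phi l) c).
move=> /cphi/ul[M _ MP].
have := MP (maxn M N) (leq_maxl _ _).
by rewrite /= uc ?leq_maxr// ltxx.
Qed.

(** * Words under collapses and uniform approximation *)

Section words.
Context {R : realType} {X : metricType R} (p : X).
Implicit Types a b : R -> X.

Lemma comp_word (phi : X -> X) a b n : phi p = p ->
  phi \o word p a b n = word p (phi \o a) (phi \o b) n.
Proof.
move=> phip; elim: n => [|n IH] /=; first by apply/funext => t /=.
by rewrite comp_pcat IH /pcomm !comp_pcat.
Qed.

Lemma loop_class_word_cst a n : is_path p p a ->
  loop_class p (word p a (cst p) n) = 1%g.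
Proof.
move=> ap; have cp : is_path p p (cst p : R -> X) by exact: is_path_cst.
elim: n => [//|n IH].
rewrite /word iterS -/(word p a (cst p) n) loop_classM; last 2 first.
- exact: is_path_pcomm.
- exact: is_path_word.
rewrite IH mulg1 loop_classM; last 2 first.
- exact: is_path_pcat ap cp.
- exact: is_path_pcat (is_path_revp ap) (is_path_revp cp).
rewrite !loop_classM//; try exact: is_path_revp.
by rewrite (loop_classV ap) (loop_classV cp) loop_class1 invg1 !mulg1 mulgV.
Qed.

Lemma entourage_pcat (T : uniformType) (E : set (T * T)) (f f' g g' : R -> T) :
  (forall t, E (f t, f' t)) -> (forall t, E (g t, g' t)) ->
  forall t, E (pcat f g t, pcat f' g' t).
Proof. by move=> Ef Eg t; rewrite /pcat; case: ifP. Qed.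

(** At each time the two words follow either the same path or corresponding points of [b] and [b'],
    possibly reversed, so the same [E] serves for every [n]. *)
Lemma entourage_word (E : set (X * X)) a b b' n : entourage E ->
  (forall t, E (b t, b' t)) -> forall t, E (word p a b n t, word p a b' n t).
Proof.
move=> entE Eb; elim: n => [|n IH] t; first exact: entourage_refl.
apply: entourage_pcat => // {}t; apply: entourage_pcat => {}t;
by apply: entourage_pcat => {}t; [exact: entourage_refl|exact: Eb].
Qed.

End words.

Lemma geometric_cauchy (R : realType) (T : Type) (d : T -> T -> R) (u : nat -> T) :
  is_metric d -> (forall j, d (u j.+1) (u j) < 2^-1 ^+ j) ->
  forall e : R, 0 < e -> exists N : nat,
    forall m n, (N <= m)%N -> (N <= n)%N -> d (u m) (u n) < e.
Proof.
move=> [d0 deq dsym dtri] du.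
have geo N k : d (u N) (u (N + k)%N) <= 2 * 2^-1 ^+ N - 2 * 2^-1 ^+ (N + k).
  elim: k => [|k IH]; first by rewrite addn0 subrr; have /deq -> := erefl (u N).
  apply: (le_trans (dtri _ (u (N + k)%N) _)).
  rewrite addnS exprS; have := du (N + k)%N; rewrite dsym => duk.
  set q := 2^-1 ^+ (N + k) in IH duk *; set q0 := 2^-1 ^+ N in IH *; lra.
move=> e e0.
(* Both terms are compared with [u N], each at a distance of at most [2 * 2^-1 ^+ N]. *)
have [N eN] : exists N : nat, 4 * 2^-1 ^+ N < e.
  have [N Ne] : exists N : nat, 4 / e < N%:R.
    by exists (Num.trunc (4 / e)).+1; exact: truncnS_gt.
  exists N; rewrite exprVn ltr_pdivrMr ?exprn_gt0// mulrC -ltr_pdivrMr//.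
  by rewrite (lt_le_trans Ne)// -natrX ler_nat ltnW// ltn_expl.
exists N => m n Nm Nn; have := geo N (m - N)%N; have := geo N (n - N)%N.
rewrite !subnKC// => gn gm.
apply: (le_lt_trans (dtri _ (u N) _)); rewrite dsym.
have qm : 0 < 2^-1 ^+ m :> R by rewrite exprn_gt0// invr_gt0.
have qn : 0 < 2^-1 ^+ n :> R by rewrite exprn_gt0// invr_gt0.
move: eN gn gm qm qn.
set q := 2^-1 ^+ N; set qm := 2^-1 ^+ m; set qn := 2^-1 ^+ n; lra.
Qed.

(** * The limit loop in the presence of a retraction *)

Section no_retract.
Context {R : realType} {X Z : metricType R} (p : X) (Y : nat -> set X).
Hypothesis Y_cover : \bigcup_n Y n = [set: X].
Hypothesis Y_wedge : forall n m, n != m -> Y n `&` Y m = [set p].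
Hypothesis Y_closed : forall n, closed (Y n).
Hypothesis Y_diam : diam (Y n) @[n --> \oo] --> 0%E.
Variables (b : nat -> R -> X) (e : X -> Z) (r : Z -> X).
Hypothesis b_path : forall n, is_path p p (b n).
Hypothesis b_Y : forall n t, Y n (b n t).
Hypotheses (ce : continuous e) (cr : continuous r) (eK : cancel e r).
Hypothesis cm : completely_metrizable R (pi1 R (e p)).

Let W k n := word p (b 0%N) (b k) n.

Lemma is_path_W k n : is_path p p (W k n).
Proof. exact: is_path_word. Qed.

Lemma cvg_append_word (g : R -> X) n : is_path p p g ->
  loop_class p (pcat g (W k n)) @[k --> \oo] --> loop_class p g.
Proof.
move=> gp.
have cp : is_path p p (cst p : R -> X) by exact: is_path_cst.
have w0p := is_path_word n (b_path 0%N) cp.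
have gw0 := is_path_pcat gp w0p.
have gw k := is_path_pcat gp (is_path_W k n).
(* The limit class is represented not by [g] but by the uniform limit of the loops themselves, in
   which [b k] is replaced by the constant loop. *)
have -> : loop_class p g = \pi_(pi1 R p) (loop_of gw0).
  by rewrite -loop_classE loop_classM// loop_class_word_cst// mulg1.
have -> : (fun k => loop_class p (pcat g (W k n))) =
    (fun k => \pi_(pi1 R p) (loop_of (gw k))).
  by apply/funext => k; rewrite -loop_classE.
have cpi : continuous (\pi_(pi1 R p) : loop_space R p -> pi1 R p).
  exact: pi_continuous.
move=> U /cpi/loop_space_nbhsP[E entE EU].
have [d /= d0 dE] : exists2 d : R, 0 < d & forall x, mdist p x < d -> E (p, x).
  have /nbhs_ballP[d /= d0 dE] := nbhs_entourage p entE.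
  by exists d => // x px; apply/xsectionP/dE; rewrite ballEmdist.
have [N NP] := Y_small Y_wedge Y_diam d0.
exists N => // k /= Nk; apply: EU => t; rewrite !loop_ofE.
apply: entourage_pcat => {}t; first exact: entourage_refl.
by apply: entourage_word => // {}t; apply: dE; exact: NP (b_Y k t).
Qed.

(* Appending ever longer words [W (k j) j] with [k j] growing fast enough gives
   a Cauchy sequence in [pi1 (e p)]; [f] represents the image of its limit. *)
Lemma limit_loop : exists (f : R -> X) (k : nat -> nat), [/\ is_path p p f,
  forall j, k j != 0%N &
  forall j, path_homotopic (collapse p Y (pair_of (k j)) \o f) (W (k j) j)].
Proof.
have [d [dM dn dc]] := cm; have [d0 deq dsym dtri] := dM.
pose c (g : R -> X) : pi1 R (e p) := loop_class (e p) (e \o g).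
have cE (g : R -> X) : is_path p p g -> c g = pi1_induced (e p) e (loop_class p g).
  by move=> gp; rewrite pi1_inducedE.
(* The triple holds the current loop, the exponent and the last index used. The condition on the
   loop is a premise so that [choice] applies to all triples. *)
have next (gjm : (R -> X) * nat * nat) : exists k, (gjm.2 < k)%N /\
    (is_path p p gjm.1.1 ->
      d (c (pcat gjm.1.1 (W k gjm.1.2))) (c gjm.1.1) < 2^-1 ^+ gjm.1.2).
  move: gjm => [[g j] m] /=.
  have [gp|] := pselect (is_path p p g); last by exists m.+1.
  have q0 : 0 < 2^-1 ^+ j :> R by rewrite exprn_gt0// invr_gt0.
  have ug : nbhs (pi1_induced (e p) e (loop_class p g))
      [set v | d (pi1_induced (e p) e (loop_class p g)) v < 2^-1 ^+ j].
    by apply/dn; exists (2^-1 ^+ j).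
  have /(cvg_append_word j gp)[N _ NP] := continuous_pi1_induced ce erefl ug.
  exists (maxn N m.+1); rewrite leq_maxr; split=> // _.
  rewrite dsym !cE//; last exact: is_path_pcat gp (is_path_W _ _).
  exact: NP (leq_maxl _ _).
have [K KP] := choice next.
(* Indices start at 0 and increase strictly, so every [k j] is nonzero and no two coincide. *)
pose st := fix st j : (R -> X) * nat := if j is i.+1 then
  let k := K ((st i).1, i, (st i).2) in (pcat (st i).1 (W k i), k) else (cst p, 0%N).
pose G j := (st j).1; pose k j := (st j.+1).2.
have GS j : G j.+1 = pcat (G j) (W (k j) j) by [].
have Gp j : is_path p p (G j).
  elim: j => [|j IH]; first exact: is_path_cst.
  by rewrite GS; exact: is_path_pcat IH (is_path_W _ _).
have kS j : ((st j).2 < k j)%N by have [] := KP (G j, j, (st j).2).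
have k0 j : k j != 0%N by rewrite -lt0n (leq_ltn_trans _ (kS j)).
have kltn i j : (i < j)%N -> (k i < k j)%N.
  elim: j => // j IH; rewrite ltnS leq_eqVlt => /predU1P[->|ij]; first exact: kS.
  exact: ltn_trans (IH ij) (kS j.+1).
have kneq i j : i != j -> k i != k j.
  by rewrite neq_ltn => /orP[] /kltn h; rewrite neq_ltn h ?orbT.
have dG j : d (c (G j.+1)) (c (G j)) < 2^-1 ^+ j.
  by have [_] := KP (G j, j, (st j).2); apply; exact: Gp.
have [l Gl] := dc _ (geometric_cauchy dM dG).
have [h hp lE] := loop_class_surj l.
have rp : r (e p) = p by rewrite eK.
pose f := r \o h.
have fp : is_path p p f by exact: (is_path_comp cr rp hp).
exists f, k; split=> // i.
pose S := pair_of (k i); pose rho := collapse p Y S.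
have crho : continuous rho by exact: continuous_collapse.
have rhop : rho p = p by exact: collapse_p.
have rhoW j : loop_class p (rho \o W (k j) j) =
    if j == i then loop_class p (W (k i) i) else 1%g.
  rewrite comp_word//.
  have -> : rho \o b 0%N = b 0%N.
    by apply/funext => t /=; exact: collapse_id (b_Y 0%N t).
  have [->|ji] := eqVneq j i.
    have -> // : rho \o b (k i) = b (k i).
    apply/funext => t /=; apply: collapse_id (b_Y (k i) t).
    by rewrite /S /pair_of eqxx orbT.
  have -> : rho \o b (k j) = cst p.
    apply/funext => t /=; apply: (collapse_base Y_wedge); exists (k j) => //.
    by rewrite /S /pair_of negb_or k0 kneq.
  exact: loop_class_word_cst.
(* Only the i-th word survives the collapse; in the others [b (k j)] becomes constant. The sequence
   of classes is thus constant from [i.+1] on. *)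
have rhoG j : loop_class p (rho \o G j) =
    if (i < j)%N then loop_class p (W (k i) i) else 1%g.
  elim: j => [|j IH].
    have -> // : rho \o G 0%N = cst p by apply/funext.
  rewrite GS comp_pcat loop_classM; last 2 first.
  - exact: (is_path_comp crho rhop (Gp j)).
  - exact: (is_path_comp crho rhop (is_path_W _ _)).
  rewrite IH rhoW ltnS; case: ltngtP => ij; rewrite ?mulg1 ?mul1g//.
(* The collapse is transported to [Z], since uniqueness of limits is available in [pi1 R (e p)];
   composing with [r] afterwards returns to [X]. *)
pose psi := e \o rho \o r.
have psip : psi (e p) = e p by rewrite /psi /= rp rhop.
have cpsi : continuous psi.
  apply: continuous_comp_fun cr _; exact: continuous_comp_fun crho ce.
have wp := is_path_W (k i) i.
have lim := @completely_metrizable_eq_lim _ _ (pi1_induced (e p) psi) _ _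
  (c (W (k i) i)) i.+1 cm (fun x => continuous_pi1_induced cpsi psip (x := x)) Gl.
have {lim} : pi1_induced (e p) psi l = c (W (k i) i).
  apply: lim => j ij; have ep := is_path_comp ce erefl (Gp j).
  rewrite /= /c (pi1_inducedE cpsi psip)//.
  have -> : psi \o (e \o G j) = e \o (rho \o G j).
    by apply/funext => t; rewrite /psi /= eK.
  rewrite -(pi1_inducedE ce erefl (is_path_comp crho rhop (Gp j))) rhoG ij.
  by rewrite pi1_inducedE.
rewrite lE (pi1_inducedE cpsi psip)//.
move=> /(loop_class_eqP (is_path_comp cpsi psip hp) (is_path_comp ce erefl wp)).
move=> /(path_homotopic_comp cr).
have -> : r \o (psi \o h) = rho \o f by apply/funext => t; rewrite /psi /= eK.
by have -> : r \o (e \o W (k i) i) = W (k i) i by apply/funext => t /=; rewrite eK.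
Qed.

End no_retract.

Theorem theorem5 (R : realType) (X Y : metricType R) (pX : X) (pY : Y) :
  similar_to_hawaiian_earring pX ->
  completely_metrizable R (pi1 R pY) ->
  ~ embeds_as_based_retract R X pY.
Proof.
move=> [P [Pcover Pwedge Pclosed Pprop Pdiam]] cm [A [[f [cf fK]] [h hh] [a Aa pa]]].
have [ch [g [cg hK gK]]] := hh.
pose e (x : X) : Y := val (h x); pose r (y : Y) : X := g (f y).
have ce : continuous e by exact: continuous_comp_fun ch (@continuous_set_type_val _ _).
have cr : continuous r by exact: continuous_comp_fun.
have eK : cancel e r by move=> x; rewrite /r /e fK hK.
(* The given point [a] of the retract is joined to [e pX] inside the image of the piece containing
   [r a]. *)
have cm' : completely_metrizable R (pi1 R (e pX)).
  apply: completely_metrizable_base_change cm; apply: path_joined_trans pa _.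
  have [n Yn] := Y_ex Pcover (r a).
  have [pc _ _] := Pprop n.
  have ra : e (r a) = a.
    have := fK (exist _ a (mem_set Aa)); rewrite /= /e /r => ->.
    by rewrite gK.
  have [G] := pc (exist _ (r a) (mem_set Yn)) (exist _ pX (mem_set (Y_base Pwedge n))).
  apply: (@path_joined_of _ _ _ _ (fun t => e (val (G t)))).
  - apply: continuous_comp_fun ce; apply: (continuous_comp_fun _ (@continuous_set_type_val _ _)).
    exact: cts_fun.
  - by rewrite path_zero.
  - by rewrite path_one.
have [b bP] := choice (fun n => let: And3 pc _ nsc := Pprop n in
  essential_loop Pcover Pwedge Pclosed Pdiam pc nsc).
have [V VP] := choice (fun n => let: And3 _ lsc _ := Pprop n in
  ex_good_nbhd Pwedge lsc).
have pc n : path_connected_space R (set_type (P n)) by have [] := Pprop n.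
have [sigma [sP sp sV]] := ex_connecting_paths Pcover Pwedge pc VP.
have bp n : is_path pX pX (b n) by have [] := bP n.
have bY n t : P n (b n t) by have [_ h' _] := bP n; exact: h'.
have b1 n : loop_class pX (b n) <> 1%g by have [] := bP n.
have [l [k [lp k0 lk]]] := limit_loop Pcover Pwedge Pclosed Pdiam bp bY ce cr eK cm'.
have [N NP] := word_length_bounded Pcover Pwedge Pclosed Pdiam VP sP sp sV bp bY b1 lp.
(* At exponent [N.+1] the bound would read [4 * N.+1 <= N]. *)
have := NP (k N.+1) N.+1 (k0 _) (lk _).
by rewrite leqNgt (leq_trans (ltnSn N))// leq_pmull.
Qed.
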